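(* Let $\Gamma$ be a finitely generated group and let $G$ be a Cayley graph of $\Gamma$ (with respect to a finite generating set closed under inverses) that is simple, bipartite and non-amenable. Let $\mu$ be the product measure on $[0,1]^\Gamma$ with each coordinate having Lebesgue measure. Then there is a $\Gamma$-factor $\phi:[0,1]^\Gamma\to\{0,1\}^{E(G)}$ such that, for $\mu$-a.e. $\omega$, $\phi(\omega)$ (viewed as a set of edges of $G$) is a perfect matching of $G$.
   Context: For a group $\Gamma$ with finite symmetric generating set $S$, the Cayley graph $G$ has vertex set $\Gamma$, the neighbors of $x$ being the elements $sx$, $s\in S$, so that $\Gamma$ acts on $G$ by automorphisms via right translations; $E(G)$ denotes its edge set. $\Gamma$ acts on $[0,1]^\Gamma$ by $(R_\gamma\omega)(x):=\omega(x\gamma)$ and on $\{0,1\}^{E(G)}$ by $(R_\gamma\xi)(\{x,y\}):=\xi(\{x\gamma,y\gamma\})$. A $\Gamma$-factor is a measurable map $\phi:[0,1]^\Gamma\to\{0,1\}^{E(G)}$ with $R_\gamma(\phi(\omega))=\phi(R_\gamma\omega)$ for all $\gamma\in\Gamma$ and all $\omega$. An element of $\{0,1\}^{E(G)}$ is identified with the set of edges where it equals $1$. A perfect matching of a graph is a set of its edges such that each vertex belongs to exactly one edge of the set. A graph $G=(V,E)$ is non-amenable if $\inf\{|\partial_E K|/|K| : \emptyset\neq K\subset V \text{ finite}\}>0$, where $\partial_E K$ is the set of edges joining $K$ to its complement. *)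

(* Defs.v *)
From HB Require Import structures.
From mathcomp Require Import all_boot all_order all_algebra finmap.
From mathcomp Require Import all_classical all_reals all_analysis.

Set Implicit Arguments.
Unset Strict Implicit.
Unset Printing Implicit Defensive.

Import Order.TTheory GRing.Theory Num.Theory.

Local Open Scope classical_set_scope.
Local Open Scope ring_scope.

Section graph.
Context {V : choiceType}.
Implicit Types (adj : V -> V -> Prop) (K : {fset V}) (M : set {fset V}).

(* Edges are vertex sets, so parallel edges cannot occur: simple means that
   there are no loops. *)
Definition simple_graph adj := forall x, ~ adj x x.

Definition bipartite adj :=
  exists side : V -> bool, forall x y, adj x y -> side x != side y.

Definition edges adj : set {fset V} :=
  [set e | exists x y, adj x y /\ e = [fset x; y]%fset].

Definition edge_boundary adj K : set {fset V} :=
  [set e | exists x y,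
    [/\ x \in K, y \notin K, adj x y & e = [fset x; y]%fset]].

(* fset_set A is a junk value for infinite A; boundaries in a Cayley graph are
   finite by finite_edge_boundary_cayley. *)
Definition nonamenable (R : realType) adj :=
  0 < inf [set (#|` fset_set (edge_boundary adj K)|%:R / #|` K|%:R : R)
          | K in [set K | K != fset0]].

Definition perfect_matching adj M :=
  M `<=` edges adj /\ forall x, exists! e, M e /\ x \in e.

End graph.

Section cayley.
Context {Gamma : groupType}.
Implicit Types (S : {fset Gamma}) (g x y : Gamma).

Definition symmetric_set S := forall s, s \in S -> (s^-1)%g \in S.

Definition generates S :=
  forall H : {pred Gamma}, group_closed H -> {subset S <= H} ->
    forall x, x \in H.

Definition cayley S x y : Prop := exists2 s, s \in S & y = (s * x)%g.

Lemma finite_edge_boundary_cayley S (K : {fset Gamma}) :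
  finite_set (edge_boundary (cayley S) K).
Proof.
apply: (@sub_finite_set _ _
  [set` [fset [fset x; (s * x)%g]%fset | x in K, s in S]%fset]); last first.
  exact: finite_fset.
move=> _ [x [_ [xK _ [s sS ->] ->]]] /=.
by apply/imfset2P; exists x => //; exists s.
Qed.

Lemma edges_mulr S g (e : edges (cayley S)) :
  [fset (x * g)%g | x in val e]%fset \in edges (cayley S).
Proof.
case: e => e /= /set_mem [x [_ [[s sS ->] ->]]]; apply/mem_set.
exists (x * g)%g, (s * x * g)%g; split; first by exists s; rewrite ?mulgA.
exact: imfset_fset2.
Qed.

Definition edge_mulr S g (e : edges (cayley S)) : edges (cayley S) :=
  exist (fun e => e \in edges (cayley S)) _ (edges_mulr g e).

End cayley.

Section product_sigma_algebra.
Context (I : Type) d (T : measurableType d).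

Definition coordinate_sets : set (set (I -> T)) :=
  \bigcup_i preimage_set_system setT (fun f => f i) measurable.

Definition product_space := g_sigma_algebraType coordinate_sets.

HB.instance Definition _ := Measurable.on product_space.

End product_sigma_algebra.

Lemma zero_in_itv01 (R : realType) : (0 : R) \in `[0, 1]%classic.
Proof. by rewrite inE /= in_itv /= lexx ler01. Qed.

HB.instance Definition _ (R : realType) :=
  isPointed.Build (`[0, 1]%classic : set R) (exist (fun x => x \in `[0, 1]%classic) 0 (zero_in_itv01 R)).

Definition unit_interval (R : realType) : Type :=
  g_sigma_algebra_preimageType (@set_val R `[0, 1]).
HB.instance Definition _ (R : realType) := Measurable.on (unit_interval R).

Section factor.
Context (R : realType) (Gamma : groupType).

Definition labels := product_space Gamma (unit_interval R).

(* The product measure is determined by its values on finite-dimensional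
   boxes. *)
Definition is_product_lebesgue (mu : set labels -> \bar R) :=
  forall (F : {fset Gamma}) (A : Gamma -> set (unit_interval R)),
    (forall x, measurable (A x)) ->
    mu [set w : labels | forall x, x \in F -> A x (w x)] =
      (\prod_(x <- F) lebesgue_measure (set_val @` A x))%E.

Definition translate_labels (g : Gamma) (w : labels) : labels :=
  fun x => w (x * g)%g.

Definition edge_configs (S : {fset Gamma}) :=
  product_space (edges (cayley S)) bool.

Definition translate_edges (S : {fset Gamma}) (g : Gamma)
  (xi : edge_configs S) : edge_configs S := fun e => xi (edge_mulr g e).

Definition edges_of (S : {fset Gamma}) (xi : edge_configs S) :
  set {fset Gamma} := [set val e | e in [set e | xi e = true]].

Definition is_factor (S : {fset Gamma}) (phi : labels -> edge_configs S) :=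
  measurable_fun setT phi /\
  forall g w, translate_edges g (phi w) = phi (translate_labels g w).

End factor.

(* Main.v *)
From HB Require Import structures.
Require Import Defs.
From mathcomp Require Import all_boot all_order all_algebra finmap.
From mathcomp Require Import all_classical all_reals all_analysis.
From mathcomp Require Import ring lra zify.

(** A factor matching is encoded by the map [f] sending a labelling [w] to the
    group element that carries the identity to its partner (the identity itself
    if it is unmatched); the partner of [x] is then [f (tr x w) * x].

    Starting from the empty matching, augmenting paths of bounded length are
    switched, at translates made disjoint by means of the labels, until almost
    surely none is left. Switching a path matches two new vertices for good, so
    the density of vertices whose partner ever changes is at most the length
    bound times the density of unmatched vertices.

    That density decays exponentially in the length bound [2 l + 1]: the set
    [A_i] of vertices at the end of an alternating walk with [i] matched edges
    issued from an unmatched vertex satisfies [mu A_(i+1) = mu (N A_i)], and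
    [A_i] is disjoint from its neighbourhood [N A_i] for [i <= l], since
    otherwise two walks would join into an augmenting path; hence
    [mu A_i <= 1/2] and [mu A_i] grows geometrically, because the neighbourhood
    of a set of measure at most [1/2] is larger by a constant factor. By
    Borel-Cantelli the matchings obtained for [l = 0, 1, 2, ...] stabilize
    almost surely.

    The expansion is a spectral gap of the Bernoulli shift: [Gamma] permutes
    the Walsh functions of the binary digits of the labels, which are indexed by
    finite subsets [U] of [Gamma * nat], and averaging over the points of [U]
    maps the finitely supported nonnegative functions of nonempty [U] to such
    functions on [Gamma] equivariantly, so that the isoperimetric inequality
    of [Gamma] passes to the index set. *)

Set Implicit Arguments.
Unset Strict Implicit.
Unset Printing Implicit Defensive.

Import Order.TTheory GRing.Theory Num.Theory numFieldNormedType.Exports.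

Local Open Scope classical_set_scope.
Local Open Scope ring_scope.

(** * Isoperimetry and the Cheeger inequality *)

Section spectral_gap.
Context {R : realType} {Gamma : groupType}.
Implicit Types (S K : {fset Gamma}).

(** Each boundary edge of [K] comes from at least one pair of a vertex [x] in [K] and a generator
    [s] with [s * x] outside [K], so counting pairs dominates counting edges; [k] is the infimum
    itself. *)
Lemma nonamenable_isoperimetry S : nonamenable R (cayley S) ->
  exists2 k : R, 0 < k & forall K,
    k * #|` K|%:R <= \sum_(x <- K) \sum_(s <- S) ((s * x)%g \notin K)%:R.
Proof.
rewrite /nonamenable; set A := (X in inf X) => A0; exists (inf A) => // K.
have [->|K0] := eqVneq K fset0; first by rewrite cardfs0 mulr0 big_seq_fset0.
have K_gt0 : 0 < #|` K|%:R :> R by rewrite ltr0n cardfs_gt0.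
rewrite -ler_pdivlMr//.
set B := edge_boundary (cayley S) K.
have /le_trans -> // : inf A <= #|` fset_set B|%:R / #|` K|%:R.
  apply: ge_inf; last by exists K.
  by exists 0 => _ [L _ <-]; rewrite divr_ge0.
rewrite ler_pM2r ?invr_gt0//.
pose bd := [seq [fset x; (s * x)%g]%fset |
            x <- K, s <- [seq s <- S | (s * x)%g \notin K]].
have /(uniq_leq_size (fset_uniq _)) : {subset fset_set B <= bd}.
  move=> e; rewrite in_fset_set; last exact: finite_edge_boundary_cayley.
  rewrite inE => -[x [y [xK yK [s sS yE] ->]]]; rewrite {}yE in yK *.
  by apply/allpairsPdep; exists x, s; split=> //; rewrite mem_filter sS andbT.
rewrite size_allpairs_dep -(ler_nat R) => /le_trans; apply.
rewrite sumnE big_map natr_sum; apply: ler_sum => x _.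
by rewrite size_filter -sum1_count natr_sum big_mkcond/= ler_sum// => s _; case: ifP.
Qed.

(** Co-area argument by induction on the size of [K]: subtracting the minimum [m] of [q] on [K]
    makes [q] vanish at one more point, the removed layer obeys the isoperimetric inequality, and
    the positive parts add up over the layers. *)
Lemma layer_cake S (k : R) K (q : Gamma -> R) :
  (forall K,
    k * #|` K|%:R <= \sum_(x <- K) \sum_(s <- S) ((s * x)%g \notin K)%:R) ->
  (forall x, 0 <= q x) -> (forall x, x \notin K -> q x = 0) ->
  k * \sum_(x <- K) q x <=
  \sum_(x <- K) \sum_(s <- S) Num.max 0 (q x - q (s * x)%g).
Proof.
move=> isoK; have [n] := ubnP #|` K|; elim: n K q => // n IHn K q Kn q_ge0 q0.
have [->|/fset0Pn[x1 x1K]] := eqVneq K fset0; first by rewrite !big_seq_fset0 mulr0.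
have [x0 x0K q_min] : exists2 x0, x0 \in K & forall x, x \in K -> q x0 <= q x.
  case: (@arg_minP _ _ _ [` x1K]%fset xpredT (fun x => q (val x))) => // i _ imin.
  by exists (val i); [exact: valP|move=> x xK; exact: (imin [` xK]%fset)].
pose m := q x0; pose q' x := if x \in K then q x - m else 0.
have qE x : x \in K -> q x = m + q' x by rewrite /q' => ->; rewrite addrC subrK.
have q'x0 : q' x0 = 0 by rewrite /q' x0K subrr.
have q'_ge0 x : 0 <= q' x.
  by rewrite /q'; case: ifPn => // xK; rewrite subr_ge0 q_min.
have /IHn : (#|` (K `\ x0)%fset| < n)%N.
  by move: Kn; rewrite (cardfsD1 x0) x0K.
move=> /(_ q' q'_ge0) IH.
(* Adding [x0] back costs nothing: [q'] vanishes there and positive parts are nonnegative. *)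
have {}IH : k * \sum_(x <- K) q' x <=
    \sum_(x <- K) \sum_(s <- S) Num.max 0 (q' x - q' (s * x)%g).
  rewrite (big_fsetD1 x0)//= q'x0 add0r; apply: le_trans (IH _) _.
    move=> x; rewrite in_fsetD1 negb_and negbK => /orP[/eqP->//|xK].
    by rewrite /q' (negPf xK).
  rewrite [leRHS](big_fsetD1 x0)//= lerDr sumr_ge0// => s _.
  by rewrite le_max lexx.
have -> : \sum_(x <- K) q x = m * #|` K|%:R + \sum_(x <- K) q' x.
  rewrite card_fset_sum1 natr_sum mulr_sumr -big_split/=.
  by apply: eq_fbigr => x xK _; rewrite mulr1 qE.
have -> : \sum_(x <- K) \sum_(s <- S) Num.max 0 (q x - q (s * x)%g) =
    m * (\sum_(x <- K) \sum_(s <- S) ((s * x)%g \notin K)%:R) +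
    \sum_(x <- K) \sum_(s <- S) Num.max 0 (q' x - q' (s * x)%g).
  rewrite mulr_sumr -big_split/=; apply: eq_fbigr => x xK _.
  rewrite mulr_sumr -big_split/=; apply: eq_bigr => s _.
  rewrite (qE _ xK); case: (boolP ((s * x)%g \in K)) => sxK /=.
    by rewrite (qE _ sxK) mulr0 add0r opprD addrACA subrr add0r.
  have -> : q' (s * x)%g = 0 by rewrite /q' (negPf sxK).
  rewrite (q0 _ sxK) !subr0 mulr1.
  by rewrite !max_r// addr_ge0// /m.
rewrite mulrDr mulrCA; apply: lerD IH; rewrite ler_wpM2l ?q_ge0//; exact: isoK.
Qed.

(** Terms with [a U] outside [P] vanish, and the others are values of [h] at distinct points of
    [P]. *)
Lemma sum_inj_le (X : choiceType) (P : {fset X}) (a : X -> X) (h : X -> R) :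
  injective a -> (forall U, 0 <= h U) -> (forall U, U \notin P -> h U = 0) ->
  \sum_(U <- P) h (a U) <= \sum_(U <- P) h U.
Proof.
move=> a_inj h_ge0 h0; rewrite -(big_map a xpredT h)/=.
have aPu : uniq (map a P) by rewrite map_inj_uniq// fset_uniq.
rewrite (bigID (mem P))/= [X in _ + X]big1 ?addr0; last by move=> U /h0.
rewrite -big_filter [leRHS](bigID (mem (map a P)))/= -[leLHS]addr0 lerD ?sumr_ge0//.
rewrite -[leRHS]big_filter le_eqVlt; apply/orP; left; apply/eqP/perm_big.
apply: uniq_perm; rewrite ?filter_uniq ?fset_uniq// => U.
by rewrite !mem_filter andbC.
Qed.

(** The equivariant kernel [m] spreads [q] to a function [Q] on [Gamma] of the same total mass, to
    which [layer_cake] applies. By convexity of the positive part, the variation of [Q] is at most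
    that of [q]. *)
Lemma pushforward_isoperimetry (X : choiceType) S (k : R)
    (act : Gamma -> X -> X) (m : X -> Gamma -> R) (P : {fset X}) K
    (q : X -> R) :
  (forall K,
    k * #|` K|%:R <= \sum_(x <- K) \sum_(s <- S) ((s * x)%g \notin K)%:R) ->
  (forall s, injective (act s)) ->
  (forall U x, 0 <= m U x) ->
  (forall s U x, m (act s U) (s * x)%g = m U x) ->
  (forall U, U \in P -> \sum_(x <- K) m U x = 1) ->
  (forall U x, U \in P -> x \notin K -> m U x = 0) ->
  (forall U, 0 <= q U) -> (forall U, U \notin P -> q U = 0) ->
  k * \sum_(U <- P) q U <=
  \sum_(U <- P) \sum_(s <- S) Num.max 0 (q U - q (act s U)).
Proof.
move=> isoK act_inj m_ge0 m_act m1 m0 q_ge0 q0.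
pose Q x := \sum_(U <- P) q U * m U x.
have -> : \sum_(U <- P) q U = \sum_(x <- K) Q x.
  rewrite exchange_big/=; apply: eq_fbigr => U UP _.
  by rewrite -mulr_sumr m1// mulr1.
apply: (le_trans (@layer_cake S k K Q isoK _ _)).
- by move=> x; rewrite sumr_ge0// => U _; rewrite mulr_ge0.
- by move=> x xK; rewrite /Q big1_fset// => U UP _; rewrite m0// mulr0.
have -> : \sum_(U <- P) \sum_(s <- S) Num.max 0 (q U - q (act s U)) =
    \sum_(x <- K) \sum_(s <- S) \sum_(U <- P)
      Num.max 0 (q U - q (act s U)) * m U x.
  rewrite [RHS]exchange_big/= [LHS]exchange_big/=; apply: eq_bigr => s _.
  rewrite [RHS]exchange_big/=; apply: eq_fbigr => U UP _.
  by rewrite -mulr_sumr m1// mulr1.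
apply: ler_sum => x _; apply: ler_sum => s _.
rewrite ge_max; apply/andP; split.
  by rewrite sumr_ge0// => U _; rewrite mulr_ge0// le_max lexx.
(* [Q (s * x)] enters with a minus sign, so the lower bound given by injectivity of [act s]
   suffices. *)
have : \sum_(U <- P) q (act s U) * m U x <= Q (s * x)%g.
  under eq_bigr do rewrite -(m_act s).
  apply: (@sum_inj_le _ P (act s) (fun U => q U * m U (s * x)%g)) => //.
    by move=> U; rewrite mulr_ge0.
  by move=> U /q0 ->; rewrite mul0r.
rewrite -(lerN2 (\sum_(U <- P) _)) -(lerD2l (Q x)) => /le_trans; apply.
rewrite -sumrB; apply: ler_sum => U _; rewrite -mulrBl ler_wpM2r//.
by rewrite le_max lexx orbT.
Qed.

(* AM-GM applied to [N - N' = <v - v', v + v'>] for [v = (c U, c' U)] and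
   [v' = (c' (act s U), c (act s U))], where [N = |v|^2] and [N' = |v'|^2]. *)
Lemma cheeger (X : choiceType) S (k : R) (act : Gamma -> X -> X)
    (P : {fset X}) (c c' : X -> R) :
  S != fset0 -> 0 < k -> (forall s, injective (act s)) ->
  (forall q : X -> R, (forall U, 0 <= q U) -> (forall U, U \notin P -> q U = 0) ->
    k * \sum_(U <- P) q U <=
    \sum_(U <- P) \sum_(s <- S) Num.max 0 (q U - q (act s U))) ->
  (forall U, U \notin P -> c U = 0) -> (forall U, U \notin P -> c' U = 0) ->
  \sum_(s <- S) \sum_(U <- P) (c U * c' (act s U) + c' U * c (act s U)) <=
  (1 - k ^+ 2 / (8 * #|` S|%:R ^+ 2)) * #|` S|%:R *
    \sum_(U <- P) (c U ^+ 2 + c' U ^+ 2).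
Proof.
move=> S0 k_gt0 act_inj iso_q c0 c'0.
pose d : R := #|` S|%:R; have d_gt0 : 0 < d by rewrite ltr0n cardfs_gt0.
pose q U := c U ^+ 2 + c' U ^+ 2; pose N := \sum_(U <- P) q U.
have q_ge0 U : 0 <= q U by rewrite addr_ge0 ?sqr_ge0.
have q0 U : U \notin P -> q U = 0 by move=> UP; rewrite /q c0// c'0// expr0n addr0.
have sum_s s : \sum_(U <- P) q (act s U) <= N by exact: sum_inj_le.
(* The minimizer of [2 * d * (1 + 2 * t ^+ 2) - 2 * t * k], the coefficient of [N] in [main]. *)
pose t := k / (4 * d).
have t_gt0 : 0 < t by rewrite divr_gt0// mulr_gt0.
pose J s U := c U * c' (act s U) + c' U * c (act s U).
have pointwise s U : 2 * J s U <=
    (1 + 2 * t ^+ 2) * (q U + q (act s U)) - 2 * t * Num.max 0 (q U - q (act s U)).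
  rewrite /J /q; set a := c U; set b := c' U; set a' := c' _; set b' := c _.
  have pt (x y : R) :
      2 * t * (x ^+ 2 - y ^+ 2) <= (x - y) ^+ 2 + 2 * t ^+ 2 * (x ^+ 2 + y ^+ 2).
    rewrite -subr_ge0 [leRHS](_ : _ =
      ((x - y) - t * (x + y)) ^+ 2 + (t * (x - y)) ^+ 2); last by ring.
    by rewrite addr_ge0 ?sqr_ge0.
  have pt0 (x y : R) : 0 <= (x - y) ^+ 2 + 2 * t ^+ 2 * (x ^+ 2 + y ^+ 2).
    by rewrite addr_ge0 ?sqr_ge0// mulr_ge0 ?addr_ge0 ?sqr_ge0// mulr_ge0 ?sqr_ge0.
  (* [pt] serves where the positive part is nonzero, [pt0] where it vanishes. *)
  have := pt a a'; have := pt b b'; have := pt0 a a'; have := pt0 b b'.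
  rewrite (addrC (b' ^+ 2)).
  by case: (lerP 0 (a ^+ 2 + b ^+ 2 - (a' ^+ 2 + b' ^+ 2))) => _; lra.
have main : 2 * (\sum_(s <- S) \sum_(U <- P) J s U) <=
    (1 + 2 * t ^+ 2) * (2 * d * N) - 2 * t * (k * N).
  apply: (@le_trans _ _ ((1 + 2 * t ^+ 2) *
      (\sum_(s <- S) \sum_(U <- P) (q U + q (act s U))) -
      2 * t * \sum_(s <- S) \sum_(U <- P) Num.max 0 (q U - q (act s U)))).
    rewrite !mulr_sumr -sumrB; apply: ler_sum => s _.
    by rewrite !mulr_sumr -sumrB; apply: ler_sum => U _; exact: pointwise.
  apply: lerB.
    rewrite ler_pM2l; last by rewrite ltr_pwDl// mulr_ge0// sqr_ge0.
    apply: (@le_trans _ _ (\sum_(s <- S) (2 * N))).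
      apply: ler_sum => s _; rewrite big_split/= mulr_natl mulr2n lerD//.
    rewrite big_const_seq count_predT iter_addr_0 -[_ *+ _]mulr_natl.
    by rewrite -/(size _) -/d mulrCA mulrA.
  rewrite ler_pM2l; last by rewrite mulr_gt0.
  rewrite [leRHS]exchange_big/=; exact: iso_q.
rewrite -/d -/N.
have -> : (1 - k ^+ 2 / (8 * d ^+ 2)) * d * N =
    2^-1 * ((1 + 2 * t ^+ 2) * (2 * d * N) - 2 * t * (k * N)).
  by rewrite /t; field; rewrite gt_eqF.
by rewrite -ler_pdivrMl ?invr_gt0// invrK.
Qed.

End spectral_gap.

(** * The Bernoulli shift *)

Section probability_real.
Context d (T : measurableType d) (R : realType) (mu : probability T R).
Implicit Types A B : set T.

Definition pr A : R := fine (mu A).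

Lemma prE A : measurable A -> mu A = (pr A)%:E.
Proof. by move=> mA; rewrite fineK// fin_num_measure. Qed.

Lemma pr_ge0 A : 0 <= pr A.
Proof. by rewrite fine_ge0. Qed.

Lemma pr_le A B : measurable A -> measurable B -> A `<=` B -> pr A <= pr B.
Proof.
by move=> mA mB AB; rewrite -lee_fin -!prE// le_measure// inE.
Qed.

Lemma prT : pr setT = 1.
Proof. by rewrite /pr probability_setT. Qed.

Lemma pr0 : pr set0 = 0.
Proof. by rewrite /pr measure0. Qed.

Lemma prU A B : measurable A -> measurable B -> A `&` B = set0 ->
  pr (A `|` B) = pr A + pr B.
Proof.
move=> mA mB AB; apply: EFin_inj; rewrite EFinD -!prE//; last exact: measurableU.
exact: measureU.
Qed.

Lemma prDI A B : measurable A -> measurable B ->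
  pr A = pr (A `\` B) + pr (A `&` B).
Proof.
move=> mA mB; rewrite -prU.
- by rewrite setDE -setIUr setUC setUv setIT.
- exact: measurableD.
- exact: measurableI.
- by rewrite setDE setIACA setICl setI0.
Qed.

Lemma prUle A B : measurable A -> measurable B -> pr (A `|` B) <= pr A + pr B.
Proof.
move=> mA mB; have -> : A `|` B = A `|` (B `\` A).
  by rewrite setDE setUIr setUCr setIT.
have mBA := measurableD mB mA.
rewrite prU// ?lerD2l ?pr_le//.
by rewrite setDE setICA setICr setI0.
Qed.

Lemma pr_le1 A : measurable A -> pr A <= 1.
Proof. by move=> mA; rewrite -prT pr_le. Qed.

Lemma pr_bigU_le (I : Type) (r : seq I) (F : I -> set T) :
  (forall i, measurable (F i)) ->
  pr (\big[setU/set0]_(i <- r) F i) <= \sum_(i <- r) pr (F i).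
Proof.
move=> mF; elim: r => [|i r IH]; first by rewrite !big_nil pr0.
rewrite !big_cons; apply: le_trans (prUle _ _) _ => //; last by rewrite lerD2l.
exact: bigsetU_measurable.
Qed.

End probability_real.

Section translations.
Context {R : realType} {Gamma : groupType}.
Notation Omega := (labels R Gamma).
Notation tr := (@translate_labels R Gamma).

Lemma trM g h w : tr g (tr h w) = tr (g * h)%g w.
Proof. by apply/funext => x; rewrite /translate_labels mulgA. Qed.

Lemma tr1 w : tr 1%g w = w.
Proof. by apply/funext => x; rewrite /translate_labels mulg1. Qed.

Lemma measurable_coordinate x (B : set (unit_interval R)) :
  measurable B -> measurable [set w : Omega | B (w x)].
Proof.
move=> mB; apply: sub_sigma_algebra; exists x => //=.
by exists B => //; rewrite setTI.
Qed.

Lemma measurable_tr g : measurable_fun setT (tr g).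
Proof.
apply: measurability; first by [].
move=> _ [_ [x _ [B mB <-]] <-]; rewrite !setTI.
exact: (measurable_coordinate (x * g)%g).
Qed.

Lemma measurable_preimage_tr g (A : set Omega) :
  measurable A -> measurable (tr g @^-1` A).
Proof. by move=> mA; rewrite -[_ @^-1` _]setTI; exact: measurable_tr. Qed.

(** The pi-system on which [is_product_lebesgue] prescribes the measure. *)
Definition boxes : set (set Omega) :=
  [set [set w | forall x, x \in FA.1 -> FA.2 x (w x)] | FA in
    [set FA : {fset Gamma} * (Gamma -> set (unit_interval R)) |
      forall x, measurable (FA.2 x)]].

Lemma measurable_box (F : {fset Gamma}) (A : Gamma -> set (unit_interval R)) :
  (forall x, measurable (A x)) ->
  measurable [set w : Omega | forall x, x \in F -> A x (w x)].
Proof.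
move=> mA; rewrite (_ : mkset _ =
    \big[setI/setT]_(x <- F) [set w : Omega | A x (w x)]).
  by apply: bigsetI_measurable => x _; exact: measurable_coordinate.
by rewrite -bigcap_fset.
Qed.

Lemma measurable_boxesE : @measurable _ Omega = <<s boxes>>.
Proof.
apply/seteqP; split.
  apply: smallest_sub; first exact: smallest_sigma_algebra.
  move=> _ [x _ [B mB <-]]; apply: sub_sigma_algebra.
  exists ([fset x]%fset, fun=> B) => //=; rewrite setTI.
  apply/seteqP; split=> [w|w Bw y]; last by rewrite inE => /eqP ->.
  by apply; rewrite inE.
apply: smallest_sub; first exact: sigma_algebra_measurable.
by move=> _ [[F A] /= mA <-]; exact: measurable_box.
Qed.

Lemma setI_closed_boxes : setI_closed boxes.
Proof.
move=> _ _ [[F A] /= mA <-] [[F' A'] /= mA' <-].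
exists ((F `|` F')%fset, fun x => (if x \in F then A x else setT) `&`
                                 (if x \in F' then A' x else setT)).
  by move=> x /=; apply: measurableI; case: ifP.
apply/seteqP; split=> w /= wFA.
  by split=> x xF; have := wFA x; rewrite inE xF ?orbT => /(_ isT) [].
by move=> x _; case: wFA => h1 h2; split; case: ifPn => // ?; [exact: h1|exact: h2].
Qed.

Variable mu : probability Omega R.
Hypothesis mu_prod : is_product_lebesgue mu.

(** The image measure agrees with [mu] on boxes, since translating a box only renames the finitely
    many constrained coordinates; boxes form a generating pi-system. *)
Lemma translation_invariant g (A : set Omega) : measurable A ->
  mu (tr g @^-1` A) = mu A.
Proof.
move=> mA; have mtr := measurable_tr g.
apply: (measure_unique boxes (fun=> setT) measurable_boxesE setI_closed_boxes
  _ _ (pushforward mu (tr g)) mu) => //.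
- move=> _; exists (fset0, fun=> setT) => //=.
  by apply/seteqP; split.
- by rewrite bigcup_const//; exists 0%N.
- move=> _ [[F B] /= mB <-]; rewrite /pushforward.
  transitivity (mu [set w : Omega | forall x,
      x \in [fset (y * g)%g | y in F]%fset -> B (x * g^-1)%g (w x)]).
    congr (mu _); apply/seteqP; split=> w /=.
      by move=> wB _ /imfsetP[y /= yF ->]; rewrite mulgK; exact: wB.
    move=> wB x xF; have := wB (x * g)%g; rewrite mulgK; apply.
    by apply/imfsetP; exists x.
  rewrite (mu_prod _ (fun x => mB (x * g^-1)%g)) (mu_prod F mB).
  rewrite big_imfset/=; last by move=> x y _ _; exact: mulIg.
  by under eq_bigr do rewrite mulgK.
- by move=> k /=; rewrite /pushforward -[X in mu X]/setT probability_setT ltry.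
Qed.

Lemma pr_tr g (A : set Omega) : measurable A -> pr mu (tr g @^-1` A) = pr mu A.
Proof. by move=> mA; rewrite /pr translation_invariant. Qed.

End translations.

(** * Binary digits of the labels *)

Section dyadic_digits.
Context {R : realType}.
Implicit Types (t : R) (K j k : nat) (b : nat -> bool).

(* The cap [2 ^ K - 1] only matters at [t = 1], which it puts in the last cell. *)
Definition cell K t : nat := minn (Num.truncn (2 ^+ K * t)) (2 ^ K).-1.

(** The binary digit of weight [2 ^- k.+1], with [1] read as [0.111...]. *)
Definition digit k t : bool := odd (cell k.+1 t).

(** [b 0] is the most significant digit. *)
Fixpoint cell_of_digits K b : nat :=
  if K is K'.+1 then ((cell_of_digits K' b).*2 + b K')%N else 0%N.

Lemma cell_lt K t : (cell K t < 2 ^ K)%N.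
Proof. by rewrite /cell gtn_min [X in _ || X]ltn_predL expn_gt0 orbT. Qed.

Lemma cell_of_digits_lt K b : (cell_of_digits K b < 2 ^ K)%N.
Proof.
elim: K => //= K IH; rewrite expnS; case: (b K); lia.
Qed.

Lemma truncn_half t : 0 <= t -> (Num.truncn (2 * t))./2 = Num.truncn t.
Proof.
move=> t0; apply/esym/truncn_def.
have /truncn_itv := mulr_ge0 (ler0n R 2) t0.
set m := Num.truncn _ => /andP[mt tm].
have := odd_double_half m; move: (m./2) => h mE.
have {mt} mt : (h%:R : R) * 2 <= 2 * t.
  by apply: le_trans mt; rewrite -natrM ler_nat; lia.
have {tm} tm : 2 * t < (h.+1%:R : R) * 2.
  apply: (lt_le_trans tm); rewrite -natrM ler_nat.
  have := leq_b1 (odd m); lia.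
by apply/andP; split; lra.
Qed.

(** The caps are compatible: halving [2 ^ K.+1 - 1] gives [2 ^ K - 1]. *)
Lemma cell_half K t : 0 <= t -> (cell K.+1 t)./2 = cell K t.
Proof.
move=> t0; rewrite /cell exprS -mulrA -[in RHS]truncn_half ?mulr_ge0 ?exprn_ge0//.
rewrite expnS; have : (0 < 2 ^ K)%N by rewrite expn_gt0.
move: (2 ^ K)%N (Num.truncn _) => p m; lia.
Qed.

Lemma cellS K t : 0 <= t -> cell K.+1 t = ((cell K t).*2 + digit K t)%N.
Proof. by move=> t0; rewrite -(cell_half K t0) /digit -[LHS]odd_double_half addnC. Qed.

(** Turns a condition on [K] digits into membership in a single cell, whose measure is known. *)
Lemma digitsP K t b : 0 <= t ->
  (forall k, (k < K)%N -> digit k t = b k) <-> cell K t = cell_of_digits K b.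
Proof.
move=> t0; elim: K => [|K IH].
  split=> // _; have := cell_lt 0 t; rewrite expn0 /=; lia.
rewrite (cellS _ t0) [cell_of_digits _ _]/=; split=> [tb|E].
  have /IH -> : forall k, (k < K)%N -> digit k t = b k.
    by move=> k kK; apply: tb; exact: ltnW.
  by rewrite tb.
have [cE dE] : cell K t = cell_of_digits K b /\ digit K t = b K.
  move: (cell K t) (cell_of_digits K b) (digit K t) (b K) E => c c'.
  by move=> [] [] /= E; split=> //; lia.
by move=> k; rewrite ltnS leq_eqVlt => /orP[/eqP->//|]; exact: (IH.2 cE).
Qed.

(** The closed right end of the last cell comes from the cap in [cell]. *)
Definition cell_itv K j : set R :=
  if j == (2 ^ K).-1 then `[j%:R / 2 ^+ K, 1]%classic
  else `[j%:R / 2 ^+ K, j.+1%:R / 2 ^+ K[%classic.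

Lemma cell_itvE K j : (j < 2 ^ K)%N ->
  `[0, 1] `&` [set t | cell K t = j] = cell_itv K j.
Proof.
move=> jK; have p0 : 0 < 2 ^+ K :> R by rewrite exprn_gt0.
have pE : (2 ^ K).-1.+1%:R = 2 ^+ K :> R by rewrite prednK ?expn_gt0// natrX.
apply/seteqP; rewrite /cell_itv; split=> t /=.
  rewrite in_itv/= => -[/andP[t0 t1]]; rewrite /cell => cE.
  have /andP[tr1 tr2] := truncn_itv (mulr_ge0 (ltW p0) t0).
  have jt : (j <= Num.truncn (2 ^+ K * t))%N by rewrite -cE geq_minl.
  have {}jt : j%:R / 2 ^+ K <= t.
    by rewrite ler_pdivrMr// mulrC (le_trans _ tr1)// ler_nat.
  case: eqP => jE; rewrite /= in_itv/= jt// ltr_pdivlMr//.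
  rewrite mulrC; apply: (lt_le_trans tr2); rewrite ler_nat.
  by move: (Num.truncn _) (2 ^ K)%N cE jE => m p; lia.
case: eqP => jE; rewrite /= !in_itv/= => /andP[].
  rewrite ler_pdivrMr// mulrC => jt t1.
  have t0 : 0 <= t by rewrite -(pmulr_rge0 _ p0) (le_trans _ jt).
  split; first by rewrite t0.
  by rewrite /cell -jE; apply/minn_idPr; rewrite truncn_ge_nat// mulr_ge0// ltW.
rewrite ler_pdivrMr// ltr_pdivlMr// mulrC => jt tj.
have t0 : 0 <= t by rewrite -(pmulr_rge0 _ p0) (le_trans _ jt).
split.
  rewrite t0 -(ler_pM2l p0) mulr1 (le_trans (ltW tj))// -natrX ler_nat.
  exact: jK.
rewrite /cell (_ : Num.truncn _ = j); last by apply: truncn_def; rewrite jt.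
apply/minn_idPl.
by rewrite -ltnS prednK ?expn_gt0.
Qed.

Lemma measurable_cell_itv K j : measurable (cell_itv K j).
Proof. by rewrite /cell_itv; case: ifP. Qed.

Lemma lebesgue_cell_itv K j : (j < 2 ^ K)%N ->
  lebesgue_measure (cell_itv K j) = (2 ^- K)%:E.
Proof.
move=> jK; have p0 : 0 < 2 ^+ K :> R by rewrite exprn_gt0.
have pE : (2 ^ K).-1.+1%:R = 2 ^+ K :> R by rewrite prednK ?expn_gt0// natrX.
have E1 : j.+1%:R / 2 ^+ K - j%:R / 2 ^+ K = 2 ^- K :> R.
  by rewrite -mulrBl -natrB// subSnn mul1r.
have E2 : j%:R / 2 ^+ K < j.+1%:R / 2 ^+ K :> R by rewrite ltr_pM2r ?invr_gt0// ltr_nat.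
have E3 : j = (2 ^ K).-1 -> 1 = j.+1%:R / 2 ^+ K :> R.
  by move=> ->; rewrite pE divff// gt_eqF.
rewrite /cell_itv; case: eqP => [/E3 {}E3|_]; rewrite lebesgue_measure_itv/= lte_fin.
  have -> : j%:R / 2 ^+ K < 1 :> R by rewrite [ltRHS]E3.
  by rewrite -EFinB -[in RHS]E1 -E3.
by rewrite E2 -EFinB E1.
Qed.

End dyadic_digits.

Section labels_digits.
Context {R : realType} {Gamma : groupType}.
Notation Omega := (labels R Gamma).
Notation tr := (@translate_labels R Gamma).

Definition lab (w : Omega) (x : Gamma) : R := set_val (w x : `[0, 1]%classic : set R).

Lemma lab_itv w x : 0 <= lab w x <= 1.
Proof.
by have := set_mem (valP (w x : `[0, 1]%classic : set R)); rewrite /= in_itv.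
Qed.

Lemma lab_ge0 w x : 0 <= lab w x.
Proof. by case/andP: (lab_itv w x). Qed.

Definition cell_set K j : set (unit_interval R) :=
  [set t : unit_interval R | cell K (set_val t : R) = j].

Lemma cell_setE K j : (j < 2 ^ K)%N ->
  cell_set K j = set_val @^-1` cell_itv K j.
Proof.
move=> jK; rewrite -cell_itvE//; apply/seteqP; split=> -[t /= tI]; last by case.
by move=> tj; split=> //; exact: set_mem tI.
Qed.

Lemma measurable_preimage_val (B : set R) : measurable B ->
  measurable (set_val @^-1` B : set (unit_interval R)).
Proof. by move=> mB; exists B => //; rewrite setTI. Qed.

Lemma measurable_cell_set K j : measurable (cell_set K j).
Proof.
have [jK|jK] := ltnP j (2 ^ K).
  rewrite cell_setE//; apply: measurable_preimage_val; exact: measurable_cell_itv.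
rewrite (_ : cell_set K j = set0) //; apply/seteqP; split=> // t /= tj.
by have := cell_lt K (set_val t : R); rewrite tj ltnNge jK.
Qed.

Lemma image_cell_set K j : (j < 2 ^ K)%N ->
  set_val @` cell_set K j = cell_itv K j :> set R.
Proof.
move=> jK; rewrite -cell_itvE//; apply/seteqP; split=> [_ [[t tI] /= tj <-]|t [t01 tj]].
  by split=> //; exact: set_mem tI.
by exists (exist _ t (mem_set t01)).
Qed.

Variable mu : probability Omega R.
Hypothesis mu_prod : is_product_lebesgue mu.

Lemma measurable_cells (F : {fset Gamma}) K (j : Gamma -> nat) :
  measurable [set w : Omega | forall x, x \in F -> cell K (lab w x) = j x].
Proof.
by apply: (@measurable_box _ _ F (fun x => cell_set K (j x))) => x; exact: measurable_cell_set.
Qed.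

Lemma pr_cells (F : {fset Gamma}) K (j : Gamma -> nat) :
  (forall x, x \in F -> j x < 2 ^ K)%N ->
  pr mu [set w : Omega | forall x, x \in F -> cell K (lab w x) = j x] =
  (2 ^- K) ^+ #|` F|.
Proof.
move=> jK; rewrite /pr.
rewrite (mu_prod F (fun x => measurable_cell_set K (j x))).
rewrite big_seq (eq_bigr (fun=> (2 ^- K)%:E)) -?big_seq; last first.
  by move=> x xF; rewrite image_cell_set ?jK// lebesgue_cell_itv// jK.
rewrite (_ : (\prod_(i <- F) (2 ^- K)%:E)%E = (\prod_(i <- F) (2 ^- K : R))%:E).
  by rewrite /= big_const_seq count_predT iter_mulr_1.
elim/big_ind2: _ => // _ x _ y -> ->; by rewrite EFinM.
Qed.

Lemma digits_cells (F : {fset Gamma}) K (b : Gamma -> nat -> bool) :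
  [set w : Omega | forall x k, x \in F -> (k < K)%N -> digit k (lab w x) = b x k] =
  [set w : Omega | forall x, x \in F -> cell K (lab w x) = cell_of_digits K (b x)].
Proof.
apply/seteqP; split=> w /= h x.
  by move=> xF; apply/digitsP => [|k kK]; [exact: lab_ge0|exact: h].
by move=> k xF kK; move: (h x xF) => /(digitsP _ _ (lab_ge0 w x)); exact.
Qed.

Lemma measurable_digits (F : {fset Gamma}) K (b : Gamma -> nat -> bool) :
  measurable [set w : Omega |
    forall x k, x \in F -> (k < K)%N -> digit k (lab w x) = b x k].
Proof. by rewrite digits_cells; exact: measurable_cells. Qed.

Lemma pr_digits (F : {fset Gamma}) K (b : Gamma -> nat -> bool) :
  pr mu [set w : Omega |
    forall x k, x \in F -> (k < K)%N -> digit k (lab w x) = b x k] =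
  (2 ^- K) ^+ #|` F|.
Proof. by rewrite digits_cells pr_cells// => x _; exact: cell_of_digits_lt. Qed.

End labels_digits.

(** * Walsh functions *)

Section finite_linear_combinations.
Context d (T : measurableType d) (R : realType) (mu : probability T R).

Lemma integrable_lin (I : Type) (r : seq I) (c : I -> R) (h : I -> T -> R) :
  (forall i, mu.-integrable setT (EFin \o h i)) ->
  mu.-integrable setT (EFin \o (fun w => \sum_(i <- r) c i * h i w)).
Proof.
move=> ih; rewrite (_ : _ \o _ = fun w => (\sum_(i <- r) (c i)%:E * (h i w)%:E)%E).
  by apply: integrable_sum => // i _; exact: (integrableZl measurableT (c i) (ih i)).
by apply/funext => w /=; rewrite -sumEFin.
Qed.

Lemma Rintegral_lin (I : Type) (r : seq I) (c : I -> R) (h : I -> T -> R) :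
  (forall i, mu.-integrable setT (EFin \o h i)) ->
  \int[mu]_w (\sum_(i <- r) c i * h i w) = \sum_(i <- r) c i * \int[mu]_w h i w.
Proof.
move=> ih; elim: r => [|i r IH].
  under eq_Rintegral do rewrite big_nil; by rewrite big_nil Rintegral_cst// mul0r.
under eq_Rintegral do rewrite big_cons.
rewrite RintegralD//.
- by rewrite big_cons IH RintegralZl.
- exact: (integrableZl measurableT (c i) (ih i)).
- exact: integrable_lin.
Qed.

Lemma integrable_indicT (A : set T) : measurable A ->
  mu.-integrable setT (EFin \o (\1_A : T -> R)).
Proof. by move=> mA; apply: integrable_indic => //; rewrite ltey_eq fin_num_measure. Qed.

Lemma Rintegral_indicT (A : set T) : measurable A ->
  \int[mu]_w (\1_A w : R) = pr mu A.
Proof. by move=> mA; rewrite /Rintegral integral_indic// setIT. Qed.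

End finite_linear_combinations.

Section walsh.
Context {R : realType} {Gamma : groupType}.
Notation Omega := (labels R Gamma).
Notation tr := (@translate_labels R Gamma).
Notation index := (Gamma * nat)%type.
Implicit Types (u : index) (U V : {fset index}) (w : Omega).

Definition bit w u : bool := digit u.2 (lab w u.1).

Definition walsh U w : R := \prod_(u <- U) (-1) ^+ bit w u.

(** The action on index sets by which translations permute the Walsh functions, see [walsh_tr]. *)
Definition shift_index (g : Gamma) U : {fset index} :=
  [fset ((u.1 * g)%g, u.2) | u in U]%fset.

Lemma walsh_tr g U w : walsh U (tr g w) = walsh (shift_index g U) w.
Proof.
rewrite /walsh big_imfset//= => -[x k] [y l] _ _ [/mulIg -> ->] //.
Qed.

(** Puts Walsh functions with different index sets over a common range, so that they multiply factor
    by factor. *)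
Lemma walsh_sub U V w : (U `<=` V)%fset ->
  walsh U w = \prod_(u <- V) (-1) ^+ (bit w u && (u \in U)).
Proof.
move=> UV; rewrite -(big_fset_incl _ UV) /=; last first.
  by move=> u _ /negPf ->; rewrite andbF.
by apply: eq_fbigr => u -> _; rewrite andbT.
Qed.

Definition symdiff U V : {fset index} := ((U `\` V) `|` (V `\` U))%fset.

Lemma in_symdiff U V u : (u \in symdiff U V) = (u \in U) (+) (u \in V).
Proof. by rewrite !inE; case: (u \in U); case: (u \in V). Qed.

(** Signs square to [1], so common indices cancel. *)
Lemma walshM U V w : walsh U w * walsh V w = walsh (symdiff U V) w.
Proof.
have s1 : (U `<=` U `|` V)%fset by exact: fsubsetUl.
have s2 : (V `<=` U `|` V)%fset by exact: fsubsetUr.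
have s3 : (symdiff U V `<=` U `|` V)%fset.
  by apply/fsubsetP => u; rewrite in_symdiff !inE; case: (u \in U).
rewrite (walsh_sub w s1) (walsh_sub w s2) (walsh_sub w s3) -big_split/=.
apply: eq_bigr => u _; rewrite in_symdiff -signr_addb; congr (_ ^+ (nat_of_bool _)).
by case: (bit w u).
Qed.

Lemma walsh0 w : walsh fset0 w = 1.
Proof. by rewrite /walsh big_seq_fset0. Qed.

Lemma symdiff_eq0 U V : (symdiff U V == fset0) = (U == V).
Proof.
apply/eqP/eqP => [E|->]; apply/fsetP => u; last by rewrite in_symdiff addbb.
by have := in_symdiff U V u; rewrite E inE => /esym/negbT; rewrite addbC negb_add => /eqP.
Qed.

Lemma shift_indexK g : cancel (shift_index g) (shift_index g^-1).
Proof.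
move=> U; apply/fsetP => -[x k].
apply/imfsetP/idP => [[_ /= /imfsetP[[y l] /= yU ->] [-> ->]]|xU]/=.
  by rewrite mulgK.
exists ((x * g)%g, k); last by rewrite /= mulgK.
by apply/imfsetP; exists (x, k).
Qed.

Lemma shift_index_inj g : injective (shift_index g).
Proof. exact: can_inj (shift_indexK g). Qed.

Variable mu : probability Omega R.
Hypothesis mu_prod : is_product_lebesgue mu.

Section patterns.
Variables (F : {fset Gamma}) (K : nat).
Notation pattern := {ffun (F * 'I_K)%type -> bool}.

(** Prescribing the first [K] digits at all points of [F] cuts the space into finitely many events
    of equal probability, on each of which every Walsh function with indices in this window is
    constant. *)
Definition pattern_set (b : pattern) : set Omega :=
  [set w | forall t, bit w (val t.1, val t.2) = b t].

Lemma pattern_setE (b : pattern) : exists be : Gamma -> nat -> bool,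
  pattern_set b = [set w : Omega | forall x k, x \in F -> (k < K)%N ->
                           digit k (lab w x) = be x k].
Proof.
(* [be] extends [b] by [false] outside the window, where it is never consulted. *)
exists (fun x k => if insub x is Some x' then
             if insub k is Some k' then b (x', k') else false else false).
apply/seteqP; split=> w /= h.
  by move=> x k xF kK; rewrite !insubT/= -h.
move=> [x k] /=; have := h (val x) (val k) (valP x) (ltn_ord k).
by rewrite !valK.
Qed.

Lemma measurable_pattern_set b : measurable (pattern_set b).
Proof. by have [be ->] := pattern_setE b; exact: measurable_digits. Qed.

Lemma pr_pattern_set b : pr mu (pattern_set b) = (2 ^- K) ^+ #|` F|.
Proof. by have [be ->] := pattern_setE b; exact: pr_digits. Qed.

Definition walsh_on U (b : pattern) : R :=
  \prod_(t : F * 'I_K) (-1) ^+ (b t && ((val t.1, val t.2) \in U)).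

Lemma walsh_patternE U w :
  (forall u, u \in U -> u.1 \in F /\ (u.2 < K)%N) ->
  walsh U w = \sum_(b : pattern) walsh_on U b * \1_(pattern_set b) w.
Proof.
move=> UFK; pose b0 : pattern := [ffun t => bit w (val t.1, val t.2)].
rewrite (bigD1 b0)//= [X in _ + X]big1 ?addr0 => [|b bb0]; last first.
  rewrite indicE memNset ?mulr0// => /= wb; move/eqP: bb0; apply.
  by apply/ffunP => t; rewrite ffunE wb.
rewrite indicE mem_set ?mulr1; last by move=> t /=; rewrite ffunE.
pose W := [fset ((val t.1, val t.2) : index) | t : F * 'I_K]%fset.
have UW : (U `<=` W)%fset.
  apply/fsubsetP => -[x k] /[dup] xU /UFK[/= xF kK].
  by apply/imfsetP; exists ([` xF]%fset, Ordinal kK).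
rewrite (walsh_sub w UW) /walsh_on /W big_imfset/=; last first.
  by move=> [x k] [y l] _ _ /= [/val_inj -> /val_inj ->].
by rewrite enumT; apply: eq_bigr => t _; rewrite ffunE.
Qed.

End patterns.

Lemma walsh_bounds U : exists (F : {fset Gamma}) K,
  forall u, u \in U -> u.1 \in F /\ (u.2 < K)%N.
Proof.
exists [fset u.1 | u in U]%fset, (\max_(u <- U) u.2).+1 => u uU; split.
  by apply/imfsetP; exists u.
by rewrite ltnS; apply: (@leq_bigmax_seq _ _ xpredT (fun u : index => u.2) u).
Qed.

Lemma integrable_walsh U : mu.-integrable setT (EFin \o walsh U).
Proof.
have [F [K UFK]] := walsh_bounds U.
have -> : walsh U = fun w => \sum_(b : {ffun F * 'I_K -> bool})
    walsh_on U b * \1_(pattern_set b) w.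
  by apply/funext => w; exact: walsh_patternE.
apply: integrable_lin.
by move=> b; apply: integrable_indicT; exact: measurable_pattern_set.
Qed.

(** The patterns are equally likely, and the sum of [walsh_on U] over all of them factors over the
    window; an index in [U] contributes the factor [-1 + 1 = 0]. *)
Lemma Rintegral_walsh U : \int[mu]_w walsh U w = (U == fset0)%:R.
Proof.
have [->|/fset0Pn[u uU]] := eqVneq U fset0.
  by under eq_Rintegral do rewrite walsh0; rewrite Rintegral_cst// [fine _]prT mulr1.
have [F [K UFK]] := walsh_bounds U.
under eq_Rintegral do rewrite (walsh_patternE _ UFK).
rewrite Rintegral_lin; last first.
  by move=> b; apply: integrable_indicT; exact: measurable_pattern_set.
have E (b : {ffun F * 'I_K -> bool}) :
    \int[mu]_w (\1_(pattern_set b) w : R) = (2 ^- K) ^+ #|` F|.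
  by rewrite Rintegral_indicT ?pr_pattern_set//; exact: measurable_pattern_set.
under eq_bigr do rewrite E.
rewrite -mulr_suml.
rewrite /walsh_on -(bigA_distr_bigA (fun (t : F * 'I_K) (e : bool) =>
  (-1) ^+ (e && ((val t.1, val t.2) \in U)) : R)).
have [uF uK] := UFK _ uU.
rewrite (bigD1 ([` uF]%fset, Ordinal uK))//= big_bool/= -surjective_pairing uU.
by rewrite expr1 expr0 addNr !mul0r.
Qed.

End walsh.

(** * Approximation of events by Walsh polynomials *)

Section set_distance.
Context d (T : measurableType d) (R : realType) (mu : probability T R).
Implicit Types A B C : set T.

(** The measure of the symmetric difference, a pseudometric on measurable sets. *)
Definition set_dist A B : R := pr mu (A `\` B) + pr mu (B `\` A).

Lemma set_dist_ge0 A B : 0 <= set_dist A B.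
Proof. by rewrite addr_ge0 ?pr_ge0. Qed.

Lemma set_dist_triangle A B C : measurable A -> measurable B -> measurable C ->
  set_dist A C <= set_dist A B + set_dist B C.
Proof.
move=> mA mB mC.
have H (X Y Z : set T) : measurable X -> measurable Y -> measurable Z ->
    pr mu (X `\` Z) <= pr mu (X `\` Y) + pr mu (Y `\` Z).
  move=> mX mY mZ; apply: le_trans (prUle _ _ _); try exact: measurableD.
  apply: pr_le; [exact: measurableD|by apply: measurableU; exact: measurableD|].
  by move=> x [Xx Zx]; have [Yx|Yx] := pselect (Y x); [right|left].
have := H A B C mA mB mC; have := H C B A mC mB mA; rewrite /set_dist; lra.
Qed.

Lemma pr_dist A B : measurable A -> measurable B ->
  `|pr mu A - pr mu B| <= set_dist A B.
Proof.
move=> mA mB; rewrite (prDI mu mA mB) (prDI mu mB mA) (setIC B A) /set_dist.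
have := pr_ge0 mu (A `\` B); have := pr_ge0 mu (B `\` A) => h1 h2.
by rewrite ler_norml; lra.
Qed.

Lemma set_distI A B C D : measurable A -> measurable B -> measurable C -> measurable D ->
  set_dist (A `&` B) (C `&` D) <= set_dist A C + set_dist B D.
Proof.
have H (X Y Z W : set T) : measurable X -> measurable Y -> measurable Z -> measurable W ->
    pr mu ((X `&` Y) `\` (Z `&` W)) <= pr mu (X `\` Z) + pr mu (Y `\` W).
  move=> mX mY mZ mW; apply: le_trans (prUle _ _ _); try exact: measurableD.
  apply: pr_le; [by apply: measurableD; exact: measurableI| |].
    by apply: measurableU; exact: measurableD.
  move=> x [[Xx Yx] nZW]; have [Zx|Zx] := pselect (Z x); [right|by left].
  by split=> // Wx; apply: nZW.
move=> mA mB mC mD.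
have := H A B C D mA mB mC mD; have := H C D A B mC mD mA mB; rewrite /set_dist; lra.
Qed.

Lemma set_distC A B : set_dist (~` A) (~` B) = set_dist A B.
Proof. by rewrite /set_dist !setDE !setCK addrC setIC [X in _ + pr mu X]setIC addrC. Qed.

End set_distance.

Section approximation.
Context {R : realType} {Gamma : groupType}.
Notation Omega := (labels R Gamma).
Notation tr := (@translate_labels R Gamma).
Notation index := (Gamma * nat)%type.
Implicit Types (C D : set Omega) (w : Omega).

(** A list may repeat index sets, which makes closure under Boolean operations immediate;
    [walsh_expansion_exists] collects the repetitions. *)
Definition walsh_polynomial C := exists L : seq (R * {fset index}),
  forall w, \1_C w = \sum_(p <- L) p.1 * walsh p.2 w.

Lemma walsh_polynomialT : walsh_polynomial setT.
Proof.
by exists [:: (1, fset0)] => w; rewrite big_seq1 walsh0 mulr1 indicT.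
Qed.

Lemma walsh_polynomialC C : walsh_polynomial C -> walsh_polynomial (~` C).
Proof.
move=> [L CL]; exists ((1, fset0) :: [seq (- p.1, p.2) | p <- L]) => w.
rewrite big_cons big_map/= walsh0 mul1r.
under eq_bigr do rewrite mulNr.
rewrite sumrN -CL !indicE in_setC.
by case: (w \in C); rewrite ?subrr ?subr0.
Qed.

Lemma walsh_polynomialI C D :
  walsh_polynomial C -> walsh_polynomial D -> walsh_polynomial (C `&` D).
Proof.
move=> [L CL] [M DM].
exists [seq (p.1 * q.1, symdiff p.2 q.2) | p <- L, q <- M] => w.
rewrite big_allpairs_dep/= indicI/= CL DM mulr_suml; apply: eq_bigr => p _.
rewrite mulr_sumr; apply: eq_bigr => q _.
by rewrite -walshM mulrACA.
Qed.

Lemma walsh_polynomialU C D :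
  walsh_polynomial C -> walsh_polynomial D -> walsh_polynomial (C `|` D).
Proof.
move=> hC hD; rewrite -[_ `|` _]setCK setCU; apply: walsh_polynomialC.
by apply: walsh_polynomialI; exact: walsh_polynomialC.
Qed.

(** The indicator is [(1 - (-1) ^+ bit w u) / 2]. *)
Lemma walsh_polynomial_bit (u : index) : walsh_polynomial [set w | bit w u].
Proof.
exists [:: (2^-1, fset0); (- 2^-1, [fset u]%fset)] => w.
rewrite big_cons big_seq1/= walsh0 /walsh big_seq_fset1 indicE.
case: (boolP (bit w u)) => wu; first by rewrite mem_set//= expr1; lra.
by rewrite memNset ?expr0 /=; [lra|exact/negP].
Qed.

(** A general [P] lets the induction on [K] go through: according to the last digit, [P] of the
    finer cell becomes one of two predicates of the coarser one. *)
Lemma walsh_polynomial_cell K x (P : pred nat) :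
  walsh_polynomial [set w | P (cell K (lab w x))].
Proof.
elim: K P => [|K IH] P.
  have c0 w : cell 0 (lab w x) = 0%N by have := cell_lt 0 (lab w x); case: cell.
  case P0 : (P 0%N).
    rewrite (_ : mkset _ = setT); first exact: walsh_polynomialT.
    by apply/seteqP; split=> w //= _; rewrite c0.
  rewrite (_ : mkset _ = ~` setT); first exact/walsh_polynomialC/walsh_polynomialT.
  by apply/seteqP; split=> w /=; rewrite ?c0 ?P0// => /(_ I).
rewrite (_ : mkset _ =
  ([set w | bit w (x, K)] `&` [set w | [pred n | P (n.*2 + 1)%N] (cell K (lab w x))]) `|`
  (~` [set w | bit w (x, K)] `&` [set w | [pred n | P n.*2] (cell K (lab w x))])).
  apply: walsh_polynomialU; apply: walsh_polynomialI => //;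
    [exact: walsh_polynomial_bit|exact/walsh_polynomialC/walsh_polynomial_bit].
apply/seteqP; split=> w /=; rewrite (cellS _ (lab_ge0 w x)) /bit/=.
  by case: (digit K _) => h; [left|right; rewrite addn0 in h].
by case: (digit K _) => -[[]|[]]// _; rewrite addn0.
Qed.

Variable mu : probability Omega R.

Definition approximable (A : set Omega) := measurable A /\
  forall e : R, 0 < e -> exists C,
    [/\ measurable C, walsh_polynomial C & set_dist mu A C < e].

Lemma approximable_poly C : measurable C -> walsh_polynomial C -> approximable C.
Proof.
move=> mC pC; split=> // e e0; exists C; split=> //.
by rewrite /set_dist setDv pr0 addr0.
Qed.

Lemma approximableC A : approximable A -> approximable (~` A).
Proof.
move=> [mA hA]; split=> [|e /hA[C [mC pC AC]]]; first exact: measurableC.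
exists (~` C); split; [exact: measurableC|exact: walsh_polynomialC|].
by rewrite set_distC.
Qed.

Lemma approximableI A B : approximable A -> approximable B -> approximable (A `&` B).
Proof.
move=> [mA hA] [mB hB]; split=> [|e e0]; first exact: measurableI.
have e2 : 0 < e / 2 by rewrite divr_gt0.
have [C [mC pC AC]] := hA _ e2; have [D [mD pD BD]] := hB _ e2.
exists (C `&` D); split; [exact: measurableI|exact: walsh_polynomialI|].
apply: le_lt_trans (set_distI mu mA mB mC mD) _; lra.
Qed.

Lemma approximableU A B : approximable A -> approximable B -> approximable (A `|` B).
Proof.
move=> hA hB; rewrite -[_ `|` _]setCK setCU; apply: approximableC.
by apply: approximableI; exact: approximableC.
Qed.

Lemma approximable0 : approximable set0.
Proof.
rewrite -setCT; apply: approximableC; apply: approximable_poly => //.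
exact: walsh_polynomialT.
Qed.

(** By continuity from below some finite partial union is within [e / 2] of the whole, and finite
    unions are approximable. *)
Lemma approximable_bigcup (A : (set Omega)^nat) :
  (forall n, approximable (A n)) -> approximable (\bigcup_n A n).
Proof.
move=> hA; have mA n : measurable (A n) by case: (hA n).
have mU : measurable (\bigcup_n A n) by exact: bigcup_measurable.
split=> // e e0; have e2 : 0 < e / 2 by rewrite divr_gt0.
pose B n := \big[setU/set0]_(i < n) A i.
have hB n : approximable (B n).
  rewrite /B; elim/big_ind : _ => [|X Y hX hY|//]; [exact: approximable0|].
  exact: approximableU.
have mB n : measurable (B n) by case: (hB n).
have UB : \bigcup_n A n = \bigcup_n B n.
  apply/seteqP; split=> w [n _ Anw]; last first.
    by move: Anw; rewrite /B -bigcup_mkord => -[k _ Akw]; exists k.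
  by exists n.+1 => //; rewrite /B big_ord_recr; right.
have BU n : B n `<=` \bigcup_n A n by rewrite UB => w Bw; exists n.
have cvgB : mu (B n) @[n --> \oo] --> mu (\bigcup_n A n).
  rewrite UB; apply: nondecreasing_cvg_mu => //; first by rewrite -UB.
  by move=> m n mn; apply/subsetPset; exact: subset_bigsetU.
have [n Bn] : exists n, pr mu (\bigcup_n A n) - e / 2 < pr mu (B n).
  have := cvgB; rewrite prE// => /fine_cvgP[_ /cvgrPdist_lt/(_ (e / 2))].
  move=> /(_ e2) [N _ /(_ N (leqnn _))] /=.
  rewrite -/(pr mu (B N)) => h; exists N.
  have /ltr_normlP[] := h; lra.
have [C [mC pC BC]] := (hB n).2 (e / 2) e2.
exists C; split=> //; apply: le_lt_trans (set_dist_triangle mu mU (mB n) mC) _.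
suff : set_dist mu (\bigcup_n A n) (B n) < e / 2 by lra.
rewrite /set_dist (_ : B n `\` _ = set0) ?pr0 ?addr0; last by rewrite setD_eq0; exact: BU.
have := prDI mu mU (mB n); rewrite (setIidr (BU n)); lra.
Qed.

Lemma approximable_sigma_algebra : sigma_algebra setT approximable.
Proof.
split; [exact: approximable0| |exact: approximable_bigcup].
by move=> A hA; rewrite setTD; exact: approximableC.
Qed.

(** The cells give dyadic lower bounds tending to [t], so a half-line is a countable union of events
    about cells. *)
Lemma cell_gtP (t a : R) : 0 <= t <= 1 ->
  a < t <-> exists K, 2 ^+ K * a < (cell K t)%:R.
Proof.
move=> /andP[t0 t1]; split=> [ta|[K]]; last first.
  have p0 : 0 < 2 ^+ K :> R by rewrite exprn_gt0.
  have /andP[tr1 _] := truncn_itv (mulr_ge0 (ltW p0) t0).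
  move=> h; rewrite -(ltr_pM2l p0); apply: lt_le_trans h _; apply: le_trans tr1.
  by rewrite ler_nat geq_minl.
have ta0 : 0 < t - a by rewrite subr_gt0.
(* Then [2 ^+ K >= K + 1 > 1 / (t - a)], so cells of level [K] are shorter than [t - a]. *)
pose K := Num.truncn (t - a)^-1; exists K.
have p0 : 0 < 2 ^+ K :> R by rewrite exprn_gt0.
have Kta : 1 < 2 ^+ K * (t - a).
  rewrite -ltr_pdivrMr// div1r.
  have /andP[_ /lt_le_trans] : K%:R <= (t - a)^-1 < K.+1%:R.
    by apply: truncn_itv; rewrite invr_ge0 ltW.
  by apply; rewrite -natrX ler_nat ltn_expl.
have /andP[_ tr2] := truncn_itv (mulr_ge0 (ltW p0) t0).
have pE : (2 ^ K).-1.+1%:R = 2 ^+ K :> R by rewrite prednK ?expn_gt0// natrX.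
have : 2 ^+ K * t <= (cell K t).+1%:R.
  rewrite /cell /minn; case: ifP => _; first exact: ltW.
  by rewrite pE ger_pMr.
rewrite -[_.+1]addn1 natrD; nra.
Qed.

(** The sets of reals whose event is approximable form a sigma-algebra, which contains the open
    half-lines by [cell_gtP]. *)
Lemma approximable_coordinate x (B : set (unit_interval R)) :
  measurable B -> approximable [set w : Omega | B (w x)].
Proof.
move=> [B' mB' <-]; rewrite setTI.
pose G := [set D : set R | approximable [set w | D (lab w x)]].
suff : G B' by [].
have sG : sigma_algebra setT G.
  split; first exact: approximable0.
    by move=> A hA; rewrite setTD; exact: approximableC.
  move=> A hA; rewrite /G/= (_ : mkset _ = \bigcup_n [set w | A n (lab w x)]).
    exact: approximable_bigcup.
  by apply/seteqP; split=> w [n]; exists n.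
move: mB'; rewrite [measurable](measurable_realfun.RGenOInfty.measurableE R).
move=> /(_ G); apply; split=> // _ [a ->].
rewrite /G/= (_ : mkset _ = \bigcup_K [set w | 2 ^+ K * a < (cell K (lab w x))%:R]).
  apply: approximable_bigcup => K; apply: approximable_poly; last first.
    exact: (walsh_polynomial_cell K x (fun n => 2 ^+ K * a < n%:R)).
  rewrite (_ : mkset _ =
      \bigcup_(j in [set j | 2 ^+ K * a < j%:R]) [set w | cell_set K j (w x)]).
    apply: bigcup_measurable => j _; apply: measurable_coordinate.
    exact: measurable_cell_set.
  apply/seteqP; split=> [w h|w [j /= h jE]]; first by exists (cell K (lab w x)).
  by rewrite /lab jE.
apply/seteqP; split=> w /=; rewrite in_itv/= andbT.
  by move=> /(cell_gtP _ (lab_itv w x))[K h]; exists K.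
by move=> [K _ h]; apply/(cell_gtP _ (lab_itv w x)); exists K.
Qed.

Lemma measurable_approximable (A : set Omega) : measurable A -> approximable A.
Proof.
move=> mA; apply: (mA approximable); split; first exact: approximable_sigma_algebra.
by move=> _ [x _ [B mB <-]]; rewrite setTI; exact: approximable_coordinate.
Qed.

End approximation.

(** * Walsh coefficients and the correlation inequality *)

Section walsh_coefficients.
Context {R : realType} {Gamma : groupType}.
Notation Omega := (labels R Gamma).
Notation tr := (@translate_labels R Gamma).
Notation index := (Gamma * nat)%type.
Implicit Types (C D : set Omega) (U : {fset index}) (S : {fset Gamma}).

(** The coefficients vanish off [P], so that [P] can be enlarged until two events share it. *)
Definition walsh_expansion C (P : {fset {fset index}}) (c : {fset index} -> R) :=
  (forall U, U \notin P -> c U = 0) /\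
  (forall w, \1_C w = \sum_(U <- P) c U * walsh U w).

Lemma sum_fset_pred1 (X : choiceType) (P : {fset X}) (f : X -> R) (a : X) :
  a \in P -> \sum_(y <- P) f y * (y == a)%:R = f a.
Proof.
move=> aP; rewrite (big_fsetD1 a)//= eqxx mulr1 big1_fset ?addr0// => y.
by rewrite in_fsetD1 => /andP[/negPf -> _] _; rewrite mulr0.
Qed.

Lemma sum_fset_pred1_supp (X : choiceType) (P : {fset X}) (f : X -> R) (a : X) :
  (forall y, y \notin P -> f y = 0) ->
  \sum_(y <- P) f y * (y == a)%:R = f a.
Proof.
move=> f0; have [/sum_fset_pred1//|aP] := boolP (a \in P).
rewrite f0// big1_fset// => y yP _; case: eqP => [ya|_]; last by rewrite mulr0.
by rewrite -ya yP in aP.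
Qed.

Lemma walsh_expansion_exists C : walsh_polynomial C ->
  exists P c, walsh_expansion C P c.
Proof.
move=> [L CL]; exists [fset p.2 | p in L]%fset, (fun U => \sum_(p <- L | p.2 == U) p.1).
split=> [U UP|w].
  rewrite big_seq_cond big1// => p /andP[pL /eqP pU]; case/negP: UP.
  by apply/imfsetP; exists p.
rewrite CL; under [RHS]eq_bigr do rewrite mulr_suml big_mkcond.
rewrite exchange_big/= [LHS]big_seq [RHS]big_seq; apply: eq_bigr => p pL.
rewrite -(@sum_fset_pred1 _ [fset p.2 | p in L]%fset (fun U => p.1 * walsh U w) p.2).
  by apply: eq_bigr => U _; rewrite eq_sym; case: eqP; rewrite ?mulr1 ?mulr0.
by apply/imfsetP; exists p.
Qed.

Lemma walsh_expansion_incl C P Q c : (P `<=` Q)%fset ->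
  walsh_expansion C P c -> walsh_expansion C Q c.
Proof.
move=> PQ [c0 Cc]; split=> [U UQ|w].
  by apply: c0; apply: contra UQ; exact: (fsubsetP PQ).
by rewrite Cc; apply: big_fset_incl => // U _ /c0 ->; rewrite mul0r.
Qed.

Lemma shift_index1 U : shift_index 1%g U = U.
Proof.
apply/fsetP => -[x k]; apply/imfsetP/idP => [[[y l] /= yU [-> ->]]|xU].
  by rewrite mulg1.
by exists (x, k); rewrite //= mulg1.
Qed.

Lemma shift_index0 g : shift_index g fset0 = fset0 :> {fset index}.
Proof. by apply/fsetP => u; rewrite inE; apply/imfsetP => -[]. Qed.

Lemma shift_index_eq0 g U : (shift_index g U == fset0) = (U == fset0).
Proof. by rewrite -{1}(shift_index0 g) (inj_eq (@shift_index_inj _ g)). Qed.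

Variable mu : probability Omega R.
Hypothesis mu_prod : is_product_lebesgue mu.

(** Only the constant Walsh function has a nonzero integral. *)
Lemma walsh_expansion_pr C P c : measurable C -> walsh_expansion C P c ->
  pr mu C = c fset0.
Proof.
move=> mC [c0 Cc]; rewrite -Rintegral_indicT//.
under eq_Rintegral do rewrite Cc.
rewrite Rintegral_lin; last exact: integrable_walsh.
by under eq_bigr do rewrite Rintegral_walsh//; rewrite sum_fset_pred1_supp.
Qed.

(** Parseval: [walsh U] times the translate of [walsh V] has integral [1] if [U] is the shift of
    [V], and [0] otherwise. *)
Lemma walsh_expansion_prI C D P c e g : measurable C -> measurable D ->
  walsh_expansion C P c -> walsh_expansion D P e ->
  pr mu (C `&` tr g @^-1` D) = \sum_(U <- P) c U * e (shift_index g^-1 U).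
Proof.
move=> mC mD [c0 Cc] [e0 De].
have mCD : measurable (C `&` tr g @^-1` D).
  by apply: measurableI => //; exact: measurable_preimage_tr.
rewrite -Rintegral_indicT//.
have E w : \1_(C `&` tr g @^-1` D) w =
    \sum_(p <- [seq (U, V) | U <- P, V <- P])
      (c p.1 * e p.2) * walsh (symdiff p.1 (shift_index g p.2)) w :> R.
  rewrite indicI/= [X in _ * X](_ : _ = \1_D (tr g w)); last first.
    by rewrite !indicE; congr (nat_of_bool _)%:R; apply/idP/idP => /set_mem/mem_set.
  rewrite Cc De big_allpairs_dep/= mulr_suml; apply: eq_bigr => U _.
  rewrite mulr_sumr; apply: eq_bigr => V _.
  by rewrite -walshM walsh_tr mulrACA.
under eq_Rintegral do rewrite E.
rewrite Rintegral_lin; last by move=> p; exact: integrable_walsh.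
under eq_bigr do rewrite Rintegral_walsh// symdiff_eq0.
rewrite big_allpairs_dep/=; apply: eq_bigr => U _.
rewrite -(sum_fset_pred1_supp (shift_index g^-1 U) e0) mulr_sumr; apply: eq_bigr => V _.
rewrite -mulrA; congr (_ * (_ * (nat_of_bool _)%:R)).
by rewrite -(inj_eq (@shift_index_inj _ g^-1%g)) shift_indexK eq_sym.
Qed.

(** The uniform distribution on [U] pushed to [Gamma] by inverting the first coordinate. The inverse
    turns right translation by [s^-1] into left multiplication by [s], which moves along edges of
    the Cayley graph. *)
Definition fiber_weight U (x : Gamma) : R :=
  (\sum_(u <- U) ((u.1^-1)%g == x)%:R) / #|` U|%:R.

Lemma fiber_weight_shift s U x : fiber_weight (shift_index s^-1 U) (s * x)%g = fiber_weight U x.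
Proof.
rewrite /fiber_weight card_imfset/=; last by move=> [y k] [z l] /= [/mulIg -> ->].
congr (_ / _); rewrite big_imfset/=; last by move=> [y k] [z l] _ _ /= [/mulIg -> ->].
by apply: eq_bigr => u _; rewrite invgM invgK (inj_eq (mulgI s)).
Qed.

(** Instance of [pushforward_isoperimetry] for [fiber_weight]. The empty index set is fixed by all
    shifts and its weights are [0] instead of summing to [1], hence its exclusion from [P]. *)
Lemma walsh_isoperimetry S (k : R) (P : {fset {fset index}}) (q : {fset index} -> R) :
  (forall K : {fset Gamma},
    k * #|` K|%:R <= \sum_(x <- K) \sum_(s <- S) ((s * x)%g \notin K)%:R) ->
  fset0 \notin P ->
  (forall U, 0 <= q U) -> (forall U, U \notin P -> q U = 0) ->
  k * \sum_(U <- P) q U <=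
  \sum_(U <- P) \sum_(s <- S) Num.max 0 (q U - q (shift_index s^-1 U)).
Proof.
move=> isoK P0 q_ge0 q0.
pose K : {fset Gamma} := [fset (u.1^-1)%g | U in P, u in (U : {fset index})]%fset.
have inK U u : U \in P -> u \in U -> (u.1^-1)%g \in K.
  by move=> UP uU; apply/imfset2P; exists U => //; exists u.
apply: (pushforward_isoperimetry (act := fun s => shift_index s^-1%g)
  (m := fiber_weight) (K := K)) => //.
- by move=> s; exact: shift_index_inj.
- by move=> U x; rewrite divr_ge0// sumr_ge0.
- exact: fiber_weight_shift.
- move=> U UP; rewrite -mulr_suml exchange_big/=.
  rewrite (_ : (\sum_(u <- U) _) = \sum_(u <- U) 1).
    rewrite big_const_seq count_predT iter_addr_0 divff// pnatr_eq0 cardfs_eq0.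
    by apply: contraNneq P0 => <-.
  apply: eq_fbigr => u uU _; rewrite -[RHS](@sum_fset_pred1 _ K (fun=> 1) (u.1^-1)%g).
    by apply: eq_bigr => x _; rewrite mul1r eq_sym.
  exact: inK uU.
- move=> U x UP xK; rewrite /fiber_weight big1_fset ?mul0r// => u uU _.
  case: eqP => // xE; case/negP: xK; rewrite -xE; exact: inK uU.
Qed.

Definition spectral_epsilon S (k : R) : R := k ^+ 2 / (8 * #|` S|%:R ^+ 2).

(** Both orders are summed to match the form bounded in [cheeger]. *)
Definition correlation S (A B : set Omega) : R :=
  \sum_(s <- S) (pr mu (A `&` tr s @^-1` B) + pr mu (B `&` tr s @^-1` A)).

(** Dropping the constant coefficient centres the indicators and leaves nonempty index sets, where
    [cheeger] applies. The squared norm of a centred indicator is its variance [p * (1 - p)]. *)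
Lemma correlation_poly S (k : R) C D :
  S != fset0 -> 0 < k ->
  (forall K : {fset Gamma},
    k * #|` K|%:R <= \sum_(x <- K) \sum_(s <- S) ((s * x)%g \notin K)%:R) ->
  measurable C -> measurable D -> walsh_polynomial C -> walsh_polynomial D ->
  correlation S C D - 2 * #|` S|%:R * pr mu C * pr mu D <=
  (1 - spectral_epsilon S k) * #|` S|%:R *
    (pr mu C * (1 - pr mu C) + pr mu D * (1 - pr mu D)).
Proof.
move=> S0 k0 isoK mC mD /walsh_expansion_exists[P1 [c Cc]].
move=> /walsh_expansion_exists[P2 [e De]].
pose P := (fset0 |` (P1 `|` P2))%fset.
have {}Cc : walsh_expansion C P c.
  by apply: walsh_expansion_incl Cc; rewrite /P fsubsetU// fsubsetUl orbT.
have {}De : walsh_expansion D P e.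
  by apply: walsh_expansion_incl De; rewrite /P fsubsetU// fsubsetUr orbT.
have P0 : fset0 \in P by rewrite !inE.
pose Q := (P `\ fset0)%fset.
pose cut (f : {fset index} -> R) U := if U == fset0 then 0 else f U.
have cut0 f : (forall U, U \notin P -> f U = 0) -> forall U, U \notin Q -> cut f U = 0.
  move=> f0 U; rewrite in_fsetD1 negb_and negbK /cut; case: eqP => //= _; exact: f0.
have sumQ (h h' : {fset index} -> R) g :
    \sum_(U <- Q) cut h U * cut h' (shift_index g^-1 U) =
    \sum_(U <- P) h U * h' (shift_index g^-1 U) - h fset0 * h' fset0.
  rewrite [in RHS](big_fsetD1 fset0)//= shift_index0 addrAC subrr add0r.
  apply: eq_fbigr => U; rewrite in_fsetD1 => /andP[/negPf U0 _] _.
  by rewrite /cut shift_index_eq0 U0.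
have sumQ2 C' h : measurable C' -> walsh_expansion C' P h ->
    \sum_(U <- Q) cut h U ^+ 2 = pr mu C' * (1 - pr mu C').
  (* The squared norm is the Parseval sum at the trivial translation. *)
  move=> mC' Ch; transitivity (\sum_(U <- Q) cut h U * cut h (shift_index 1^-1 U)).
    by apply: eq_bigr => U _; rewrite invg1 shift_index1 expr2.
  rewrite sumQ -(walsh_expansion_prI 1%g mC' mC' Ch Ch) -(walsh_expansion_pr mC' Ch).
  rewrite (_ : tr 1%g @^-1` C' = C') ?setIid; first by rewrite mulrBr mulr1.
  by apply/seteqP; split=> w /=; rewrite tr1.
have iso_q (q : {fset index} -> R) : (forall U, 0 <= q U) ->
    (forall U, U \notin Q -> q U = 0) -> k * \sum_(U <- Q) q U <=
    \sum_(U <- Q) \sum_(s <- S) Num.max 0 (q U - q (shift_index s^-1 U)).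
  by apply: walsh_isoperimetry => //; rewrite !inE eqxx.
have := @cheeger R _ _ S k (fun s => shift_index s^-1%g) Q (cut c) (cut e) S0 k0
  (fun s => @shift_index_inj _ _) iso_q (cut0 c Cc.1) (cut0 e De.1).
rewrite big_split/= (sumQ2 C c)// (sumQ2 D e)//; apply: le_trans.
rewrite /correlation (_ : 2 * _ * _ * _ =
    \sum_(s <- S) (2 * pr mu C * pr mu D)); last first.
  rewrite big_const_seq count_predT iter_addr_0 -[RHS]mulr_natr; ring.
rewrite -sumrB ler_sum// => s _; rewrite big_split/= !sumQ.
rewrite -(walsh_expansion_prI s mC mD Cc De) -(walsh_expansion_prI s mD mC De Cc).
rewrite -(walsh_expansion_pr mC Cc) -(walsh_expansion_pr mD De).
lra.
Qed.

End walsh_coefficients.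

(** * Expansion of the Bernoulli shift *)

Section expansion.
Context {R : realType} {Gamma : groupType}.
Notation Omega := (labels R Gamma).
Notation tr := (@translate_labels R Gamma).
Implicit Types (A B C D : set Omega).
Variable S : {fset Gamma}.

Variable mu : probability Omega R.
Hypothesis mu_prod : is_product_lebesgue mu.

Lemma set_dist_tr g A B : measurable A -> measurable B ->
  set_dist mu (tr g @^-1` A) (tr g @^-1` B) = set_dist mu A B.
Proof.
move=> mA mB; rewrite /set_dist -(pr_tr mu_prod g (measurableD mA mB)).
by rewrite -(pr_tr mu_prod g (measurableD mB mA)).
Qed.

Lemma pr_capI_le g A B C D : measurable A -> measurable B -> measurable C -> measurable D ->
  pr mu (A `&` tr g @^-1` B) <=
  pr mu (C `&` tr g @^-1` D) + (set_dist mu A C + set_dist mu B D).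
Proof.
move=> mA mB mC mD; rewrite -(set_dist_tr g mB mD).
have mtB := measurable_preimage_tr g mB; have mtD := measurable_preimage_tr g mD.
have := set_distI mu mA mtB mC mtD.
have := pr_dist mu (measurableI _ _ mA mtB) (measurableI _ _ mC mtD).
by move=> /ler_normlP[_ h1] h2; lra.
Qed.

(** Both sides are Lipschitz for [set_dist], so the inequality passes from Walsh polynomials to all
    events by approximation. *)
Lemma correlation_measurable (k : R) A B :
  S != fset0 -> 0 < k ->
  (forall K : {fset Gamma},
    k * #|` K|%:R <= \sum_(x <- K) \sum_(s <- S) ((s * x)%g \notin K)%:R) ->
  measurable A -> measurable B ->
  correlation mu S A B - 2 * #|` S|%:R * pr mu A * pr mu B <=
  (1 - spectral_epsilon S k) * #|` S|%:R *
    (pr mu A * (1 - pr mu A) + pr mu B * (1 - pr mu B)).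
Proof.
move=> S0 k0 isoK mA mB.
pose n : R := #|` S|%:R; pose r := 1 - spectral_epsilon S k.
pose G (X Y : set Omega) := correlation mu S X Y - 2 * n * pr mu X * pr mu Y -
  r * n * (pr mu X * (1 - pr mu X) + pr mu Y * (1 - pr mu Y)).
rewrite -subr_le0 -/n -/r -/(G A B).
have n0 : 0 <= n by rewrite ler0n.
(* Per unit of distance, the correlations contribute [2 * n], the products of measures [2 * n], and
   the variances [n] times the absolute value of [r]. *)
pose M := n * (4 + `|r|).
have M0 : 0 <= M by rewrite mulr_ge0// addr_ge0.
have GM C D : measurable C -> measurable D ->
    G A B <= G C D + M * (set_dist mu A C + set_dist mu B D).
  move=> mC mD.
  have dA := pr_dist mu mA mC; have dB := pr_dist mu mB mD.
  move: (set_dist_ge0 mu A C) (set_dist_ge0 mu B D) dA dB.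
  have cor : correlation mu S A B <= correlation mu S C D +
      n * (2 * (set_dist mu A C + set_dist mu B D)).
    rewrite /n -[n * _]mulrC mulr_natr -(iter_addr_0 _ (2 * _)).
    rewrite -[X in iter X](count_predT S) -big_const_seq -big_split/=.
    apply: ler_sum => s _.
    have := pr_capI_le s mA mB mC mD; have := pr_capI_le s mB mA mD mC.
    lra.
  move: (set_dist mu A C) (set_dist mu B D) cor => d1 d2 cor d1_0 d2_0.
  move: (pr_ge0 mu A) (pr_le1 mu mA) (pr_ge0 mu B) (pr_le1 mu mB).
  move: (pr_ge0 mu C) (pr_le1 mu mC) (pr_ge0 mu D) (pr_le1 mu mD).
  rewrite /G; move: (pr mu A) (pr mu B) (pr mu C) (pr mu D) cor => a b c d.
  move: (correlation _ _ _ _) (correlation _ _ _ _) => J J' cor.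
  move=> c0 c1 d0 d1' a0 a1 b0 b1 /ler_normlP[ac1 ac2] /ler_normlP[bd1 bd2].
  have h1 : c * d - a * b <= d1 + d2.
    have -> : c * d - a * b = c * (d - b) + b * (c - a) by ring.
    by nra.
  (* The function [x * (1 - x)] is 1-Lipschitz on the unit interval. *)
  have h2 (x y e : R) : 0 <= x -> x <= 1 -> 0 <= y -> y <= 1 -> 0 <= e ->
      - (x - y) <= e -> x - y <= e ->
      r * (y * (1 - y) - x * (1 - x)) <= `|r| * e.
    move=> x0 x1 y0 y1 e0 h h'; apply: le_trans (ler_norm _) _.
    rewrite normrM ler_wpM2l// (_ : _ - _ = (y - x) * (1 - x - y)); last by ring.
    rewrite normrM -[leRHS]mulr1 ler_pM// ler_norml; lra.
  have hA := h2 _ _ _ a0 a1 c0 c1 d1_0 ac1 ac2.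
  have hB := h2 _ _ _ b0 b1 d0 d1' d2_0 bd1 bd2.
  rewrite /M -subr_ge0.
  have : 0 <= n * (2 * (d1 + d2 - (c * d - a * b))) by rewrite mulr_ge0//; lra.
  have : 0 <= n * (`|r| * d1 - r * (c * (1 - c) - a * (1 - a))).
    by rewrite mulr_ge0// subr_ge0.
  have : 0 <= n * (`|r| * d2 - r * (d * (1 - d) - b * (1 - b))).
    by rewrite mulr_ge0// subr_ge0.
  lra.
apply/ler_addgt0Pr => e e0; rewrite add0r.
have M1 : 0 < M + 1 by rewrite ltr_wpDl.
pose E := e / (2 * (M + 1)).
have E0 : 0 < E by rewrite divr_gt0// mulr_gt0.
have eE : e = (M + 1) * (2 * E) by rewrite /E; field; rewrite gt_eqF.
have [C [mC pC AC]] := (measurable_approximable mu mA).2 _ E0.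
have [D [mD pD BD]] := (measurable_approximable mu mB).2 _ E0.
apply: le_trans (GM C D mC mD) _.
have GCD : G C D <= 0 by rewrite subr_le0; exact: correlation_poly.
move: (set_dist_ge0 mu A C) (set_dist_ge0 mu B D).
have dE : set_dist mu A C + set_dist mu B D <= 2 * E.
  by rewrite mulr_natl mulr2n lerD// ltW.
move: (_ + _) dE => d dE _ _; rewrite eE -[leRHS]add0r lerD//.
apply: le_trans (ler_wpM2l M0 dE) _; rewrite ler_wpM2r ?lerDl//.
by rewrite mulr_ge0// ltW.
Qed.

(** [A] holds as seen from some neighbour of the identity. *)
Definition nbhd_set A : set Omega := [set w | exists2 s, s \in S & A (tr s w)].

Lemma measurable_nbhd_set A : measurable A -> measurable (nbhd_set A).
Proof.
move=> mA; rewrite (_ : nbhd_set A = \big[setU/set0]_(s <- S) (tr s @^-1` A)).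
  by apply: bigsetU_measurable => s _; exact: measurable_preimage_tr.
by rewrite -bigcup_fset; apply/seteqP; split=> w [s sS As]; exists s.
Qed.

Lemma nbhd_set_ge A : S != fset0 -> measurable A -> pr mu A <= pr mu (nbhd_set A).
Proof.
move=> /fset0Pn[s sS] mA; rewrite -(pr_tr mu_prod s mA) pr_le//.
- exact: measurable_preimage_tr.
- exact: measurable_nbhd_set.
- by move=> w Aw; exists s.
Qed.

(** Without generators a one-point set would have no boundary. *)
Lemma nonamenable_gens : nonamenable R (cayley S) -> S != fset0.
Proof.
move=> /nonamenable_isoperimetry[k k0 isoK].
apply/eqP => S0; have := isoK [fset 1%g]%fset.
by rewrite cardfs1 big_seq_fset1 S0 big_seq_fset0 mulr1 leNgt k0.
Qed.

(** Every translate of [A] by a generator lies in the neighbourhood, so their correlation takes its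
    largest value [2 * n * a]. For [a <= 1/2] the spectral bound then forces growth by a constant
    factor. *)
Lemma expansion : symmetric_set S -> nonamenable R (cayley S) ->
  exists2 l : R, 1 < l & forall A, measurable A -> pr mu A <= 2^-1 ->
    l * pr mu A <= pr mu (nbhd_set A).
Proof.
move=> symS naS; have S0 := nonamenable_gens naS.
have [k k0 isoK] := nonamenable_isoperimetry naS.
(* A one-point set has at most one outgoing pair per generator; [k <= n] will give [e <= 1]. *)
have kS : k <= #|` S|%:R.
  have := isoK [fset 1%g]%fset; rewrite cardfs1 big_seq_fset1 mulr1 => /le_trans; apply.
  rewrite card_fset_sum1 natr_sum; apply: ler_sum => s _.
  by case: (_ \notin _).
pose n : R := #|` S|%:R; have n0 : 0 < n by rewrite ltr0n cardfs_gt0.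
pose e := spectral_epsilon S k.
have e0 : 0 < e by rewrite divr_gt0 ?exprn_gt0// mulr_gt0// exprn_gt0.
have e1 : e <= 1.
  rewrite /e /spectral_epsilon ler_pdivrMr ?mulr_gt0 ?exprn_gt0// mul1r -/n; nra.
exists (1 + e / 2); first lra.
move=> A mA a2; have mB := measurable_nbhd_set mA.
have := correlation_measurable S0 k0 isoK mA mB.
have := nbhd_set_ge S0 mA.
have -> : correlation mu S A (nbhd_set A) = 2 * n * pr mu A.
  transitivity (\sum_(s <- S) (2 * pr mu A)); last first.
    by rewrite big_const_seq count_predT iter_addr_0 -[LHS]mulr_natr; ring.
  apply: eq_fbigr => s sS _; rewrite mulr_natl mulr2n; congr (_ + _).
    congr (pr mu _); apply/setIidPl => w Aw; exists (s^-1)%g; first exact: symS.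
    by rewrite trM mulVg tr1.
  rewrite (_ : _ `&` _ = tr s @^-1` A) ?pr_tr//.
  by apply/setIidPr => w Aw; exists s.
rewrite -/e -/n; have := pr_ge0 mu A.
move: (pr mu A) (pr mu (nbhd_set A)) a2 => a b a2 a0 ab.
have -> : 2 * n * a - 2 * n * a * b = n * (2 * a * (1 - b)) by ring.
have -> : (1 - e) * n * (a * (1 - a) + b * (1 - b)) =
    n * ((1 - e) * (a * (1 - a) + b * (1 - b))) by ring.
rewrite ler_pM2l// => H.
have [x bE] : exists x, b = a + x by exists (b - a); rewrite addrC subrK.
rewrite {}bE in H ab *; rewrite lerDl in ab.
(* [H2], [H3] and [H4] combine to [e * a <= x]: the right side of [H2] is at most
   [2 * a * x + x * (1 - 2 * a) = x]. *)
have H2 : 2 * e * a * (1 - a) <= 2 * a * x + (1 - e) * (x * (1 - 2 * a) - x ^+ 2).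
  by move: H; lra.
have H3 : (1 - e) * (x * (1 - 2 * a) - x ^+ 2) <= x * (1 - 2 * a).
  have a2' : 0 <= 1 - 2 * a by lra.
  have := mulr_ge0 (ltW e0) (mulr_ge0 ab a2').
  have : 0 <= (1 - e) * x ^+ 2 by rewrite mulr_ge0 ?sqr_ge0//; lra.
  lra.
have H4 : e * a <= 2 * e * a * (1 - a).
  have a2' : 0 <= 1 - 2 * a by lra.
  have := mulr_ge0 (mulr_ge0 (ltW e0) a0) a2'.
  lra.
lra.
Qed.

End expansion.

(** * Augmenting paths *)

Section augmenting.
Local Open Scope nat_scope.
Context {V : eqType} (adj : rel V) (side : V -> bool) (M : V -> V).
Hypothesis adj_sym : symmetric adj.
Hypothesis adj_side : forall x y, adj x y -> side x != side y.
Hypothesis MK : involutive M.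
Hypothesis M_adj : forall x, M x != x -> adj x (M x).

Definition pair_vertices (z : seq (V * V)) := unzip1 z ++ unzip2 z.

(* Re-pairing its vertices along [z] matches all of them, including the
   previously unmatched [(head z).1], and affects no other vertex. *)
Definition augmenting (z : seq (V * V)) :=
  [/\ exists a b t, z = (a, b) :: t /\ M a = a,
      uniq (pair_vertices z),
      {in z, forall p, adj p.1 p.2} &
      {in pair_vertices z, forall x, M x \in pair_vertices z}].

(** A step goes to the partner of [b] and on to a neighbour of it, so a path records every second
    vertex of an alternating walk. *)
Let step b b' := adj (M b) b'.

(** The list pairs [a] with the first vertex of the path, then the partner of each path vertex with
    the next one. Path vertices lie on the side opposite to [a] and their partners on that of [a],
    so once repetitions are removed all vertices are distinct. *)
Lemma alternating_path_augmenting a b p :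
  M a = a -> adj a b -> path step b p -> M (last b p) = last b p ->
  exists2 z, augmenting z & size z <= (size p).+1.
Proof.
move=> Ma ab bp Mlast.
pose step' b b' := (M b != b) && step b b'.
(* Cutting at the first unmatched vertex makes every step start with a genuine matching edge. *)
have [p1 [p1p Mp1 sp1]] : exists p1,
    [/\ path step' b p1, M (last b p1) = last b p1 & size p1 <= size p].
  elim: p b bp Mlast {ab} => [|b' p IH] b /=; first by exists [::].
  move=> /andP[bb' b'p] Mlast; have [Mb|Mb] := eqVneq (M b) b.
    by exists [::].
  have [p1 [h1 h2 h3]] := IH b' b'p Mlast.
  by exists (b' :: p1); split=> //=; rewrite /step' Mb bb'.
(* Removing loops makes the path simple and keeps its end. *)
case: (shortenP p1p) Mp1 => p2 p2p p2u p21 Mp2.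
have {p21}sp2 : size p2 <= size p.
  by apply: leq_trans sp1; apply: uniq_leq_size => //; case/andP: p2u.
suff [z hz sz] : exists2 z, augmenting z & size z <= (size p2).+1.
  by exists z => //; exact: leq_trans sz _.
move: p2 p2p p2u Mp2 {sp2 p bp Mlast p1 p1p sp1} => p' p2p p2u Mp2.
have matched x : x \in belast b p' -> M x != x.
  elim: p' b p2p {ab p2u Mp2} => //= b' p' IH b /andP[/andP[Mb _] b'p'].
  by rewrite inE => /orP[/eqP->//|/IH]; apply.
have sideb x : x \in b :: p' -> side x = ~~ side a.
  have : side b = ~~ side a.
    by have := adj_side ab; case: (side a) (side b) => [] [].
  elim: p' b p2p {ab p2u Mp2 matched} => [|b' p' IH] b /=.
    by move=> _ sb; rewrite inE => /eqP->.
  move=> /andP[/andP[Mb bb'] b'p'] sb; rewrite inE => /orP[/eqP->//|].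
  apply: IH => //; rewrite -sb; have := adj_side bb'; have := adj_side (M_adj Mb).
  by case: (side b) (side (M b)) (side b') => [] [] [].
have bsE := lastI b p'.
have sub_belast x : x \in belast b p' -> x \in b :: p'.
  by move=> xb; rewrite bsE mem_rcons inE xb orbT.
have sidea x : x \in map M (belast b p') -> side x = side a.
  move=> /mapP[y yb ->]; have := adj_side (M_adj (matched y yb)).
  rewrite (sideb y) ?sub_belast//.
  by case: (side a) (side (M y)) => [] [].
pose l1 := a :: map M (belast b p').
pose l2 := b :: p'.
have sl : size l1 = size l2 by rewrite /= size_map size_belast.
have z1 : unzip1 (zip l1 l2) = l1 by rewrite unzip1_zip// sl.
have z2 : unzip2 (zip l1 l2) = l2 by rewrite unzip2_zip// sl.
exists (zip l1 l2); last by rewrite size_zip sl minnn.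
rewrite /augmenting /pair_vertices z1 z2; split.
- by exists a, b, (zip (map M (belast b p')) p').
- rewrite cat_uniq p2u andbT; apply/andP; split.
    rewrite /= map_inj_uniq; last exact: inv_inj.
    apply/andP; split; last by move: p2u; rewrite bsE rcons_uniq => /andP[].
    apply/mapP => -[x xb ax]; have := matched x xb.
    by rewrite -ax -Ma ax MK eqxx.
  apply/hasPn => x /sideb sx; apply/negP => /=; rewrite inE => /orP[/eqP xa|/sidea sx'].
    by move: sx; rewrite xa; case: (side a).
  by move: sx; rewrite sx'; case: (side a).
- move=> [x y] /=; rewrite inE => /orP[/eqP[-> ->]//|].
  elim: p' b p2p {ab p2u Mp2 matched sideb bsE sub_belast sidea l1 l2 sl z1 z2}.
    by [].
  move=> b' p' IH b /=.
  by move=> /andP[/andP[_ bb'] /IH{}IH]; rewrite inE => /orP[/eqP[-> ->]|].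
- move=> x; rewrite mem_cat => /orP[|].
    rewrite inE => /orP[/eqP->|/mapP[y yb ->]]; first by rewrite Ma mem_cat mem_head.
    by rewrite MK mem_cat sub_belast// orbT.
  rewrite [in X in X -> _]/l2 bsE mem_rcons inE => /orP[/eqP->|xb].
    by rewrite Mp2 mem_cat [in X in _ || X]/l2 mem_last orbT.
  by rewrite mem_cat inE map_f ?orbT.
Qed.

(** Induction on [p] reverses the first path onto the second: [w :: q] is an alternating path from
    [M v], since [M (M v) = v] is adjacent to [w], and [v1] is adjacent to [M v]. Once [p] is
    exhausted, [v] is unmatched and the previous lemma applies. *)
Lemma join_alternating_paths v w p q :
  adj v w -> path step v p -> M (last v p) = last v p ->
  path step w q -> M (last w q) = last w q ->
  exists2 z, augmenting z & size z <= (size p + size q).+1.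
Proof.
elim: p v w q => [|v1 p IH] v w q vw /=.
  by move=> _ Mv wq Mq; exact: (alternating_path_augmenting Mv vw wq Mq).
move=> /andP[vv1 v1p] Mp wq Mq; rewrite addSnnS.
apply: (IH v1 (M v) (w :: q)) => //=; first by rewrite adj_sym.
by rewrite wq andbT /step MK.
Qed.

End augmenting.

(** * Factor matchings *)

Section mate.
Context {V : eqType}.
Implicit Types (z : seq (V * V)).

(** Exchanges the two halves of [pair_vertices z]; off these vertices the default [x] makes it the
    identity. *)
Definition mate z (x : V) : V :=
  nth x (unzip2 z ++ unzip1 z) (index x (pair_vertices z)).

Lemma mateE z x y : uniq (pair_vertices z) -> (x, y) \in z ->
  mate z x = y /\ mate z y = x.
Proof.
move=> zu xyz; have [i iz E] : exists2 i, (i < size z)%N & nth (x, y) z i = (x, y).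
  by exists (index (x, y) z); rewrite ?index_mem ?nth_index.
have s1 : size (unzip1 z) = size z by rewrite size_map.
have s2 : size (unzip2 z) = size z by rewrite size_map.
have x1 : x = nth x (unzip1 z) i by rewrite (nth_map (x, y))// E.
have y2 : y = nth y (unzip2 z) i by rewrite (nth_map (x, y))// E.
have ix : index x (pair_vertices z) = i.
  rewrite {1}x1 /pair_vertices index_cat mem_nth ?s1// index_uniq ?s1//.
  by move: zu; rewrite cat_uniq => /andP[].
have iy : index y (pair_vertices z) = (size z + i)%N.
  rewrite [in LHS]y2 -[RHS](@index_uniq _ y (size z + i) (pair_vertices z))//.
    by rewrite /pair_vertices nth_cat s1 ltnNge leq_addr/= addKn.
  by rewrite /pair_vertices size_cat s1 s2 ltn_add2l.
rewrite /mate ix iy !nth_cat s2 iz ltnNge leq_addr/= addKn; split.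
  by rewrite (nth_map (x, y))// E.
by rewrite (nth_map (x, y))// E.
Qed.

Lemma pair_verticesP z x : reflect
  (exists y, (x, y) \in z \/ (y, x) \in z) (x \in pair_vertices z).
Proof.
rewrite mem_cat; apply: (iffP orP) => [[] /mapP[[a b] abz ->]|[y []]xyz].
- by exists b; left.
- by exists a; right.
- by left; apply/mapP; exists (x, y).
- by right; apply/mapP; exists (y, x).
Qed.

Lemma mem_mate z x : uniq (pair_vertices z) -> x \in pair_vertices z ->
  mate z x \in pair_vertices z.
Proof.
move=> zu /pair_verticesP[y [] xyz]; have [Ex Ey] := mateE zu xyz; rewrite ?Ex ?Ey.
  by apply/pair_verticesP; exists x; right.
by apply/pair_verticesP; exists x; left.
Qed.

Lemma mateK z x : uniq (pair_vertices z) -> x \in pair_vertices z ->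
  mate z (mate z x) = x.
Proof.
by move=> zu /pair_verticesP[y [] xyz]; have [Ex Ey] := mateE zu xyz; rewrite ?Ex ?Ey ?Ex.
Qed.

Lemma mate_adj (adj : rel V) z x : symmetric adj ->
  uniq (pair_vertices z) -> {in z, forall p, adj p.1 p.2} ->
  x \in pair_vertices z -> adj x (mate z x).
Proof.
move=> adj_sym zu zadj /pair_verticesP[y [] xyz]; have [Ex Ey] := mateE zu xyz; rewrite ?Ex ?Ey.
  exact: (zadj _ xyz).
by rewrite adj_sym; exact: (zadj _ xyz).
Qed.

End mate.

Section factor_matching.
Context {R : realType} {Gamma : groupType}.
Notation Omega := (labels R Gamma).
Notation tr := (@translate_labels R Gamma).
Variable S : {fset Gamma}.
Hypothesis symS : symmetric_set S.
Hypothesis simpleS : simple_graph (cayley S).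
Implicit Types (f : Omega -> Gamma) (w : Omega) (z : seq (Gamma * Gamma)).

Definition adj : rel Gamma := fun x y => (y * x^-1)%g \in S.

Lemma adj_sym : symmetric adj.
Proof.
by move=> x y; apply/idP/idP => /symS; rewrite invgM invgK.
Qed.

Lemma one_notin_gens : 1%g \notin S.
Proof. by apply/negP => S1; apply: (simpleS (x := 1%g)); exists 1%g; rewrite ?mulg1. Qed.

(** The last condition makes [partner] an involution, see [partnerK]. *)
Definition factor_matching f := [/\
  forall g, measurable (f @^-1` [set g]),
  forall w, f w = 1%g \/ f w \in S &
  forall w, f (tr (f w) w) = (f w)^-1%g].

Definition partner f w (x : Gamma) : Gamma := (f (tr x w) * x)%g.

Lemma partnerK f w : factor_matching f -> involutive (partner f w).
Proof.
by case=> _ _ fV x; rewrite /partner -trM fV mulgA mulVg mul1g.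
Qed.

Lemma partner_adj f w x : factor_matching f -> partner f w x != x -> adj x (partner f w x).
Proof.
case=> _ fS _; rewrite /adj /partner mulgK.
by case: (fS (tr x w)) => // ->; rewrite mul1g eqxx.
Qed.

Lemma partner_tr f w x y : partner f (tr x w) y = (partner f w (y * x) * x^-1)%g.
Proof. by rewrite /partner trM -!mulgA mulgV mulg1. Qed.

Lemma measurable_values f (P : set Gamma) : factor_matching f ->
  measurable (f @^-1` P).
Proof.
move=> [mf fS _].
rewrite (_ : _ @^-1` _ = \big[setU/set0]_(g <- (1%g |` S)%fset)
    (if g \in P then f @^-1` [set g] else set0)).
  by apply: bigsetU_measurable => g _; case: ifP.
rewrite -bigcup_fset; apply/seteqP; split=> w /=.
  move=> Pfw; exists (f w) => /=; last by rewrite mem_set.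
  by rewrite !inE; case: (fS w) => ->; rewrite ?eqxx ?orbT.
by move=> [g _]; case: ifP => // /set_mem Pg /= ->.
Qed.

Lemma measurable_agree f f' : factor_matching f -> factor_matching f' ->
  measurable [set w | f w = f' w].
Proof.
move=> [mf fS fV] [mf' f'S f'V].
rewrite (_ : mkset _ = \big[setU/set0]_(g <- (1%g |` S)%fset)
    (f @^-1` [set g] `&` f' @^-1` [set g])).
  by apply: bigsetU_measurable => g _; exact: measurableI.
rewrite -bigcup_fset; apply/seteqP; split=> w /=.
  move=> ff'; exists (f w) => //=.
  by rewrite !inE; case: (fS w) => ->; rewrite ?eqxx ?orbT.
by move=> [g _ [-> ->]].
Qed.

Lemma measurable_partner f x (P : set Gamma) : factor_matching f ->
  measurable [set w | P (partner f w x)].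
Proof.
move=> mf; apply: (measurable_preimage_tr x (A := f @^-1` [set g | P (g * x)%g])).
exact: measurable_values.
Qed.

Definition augmentable f z : set Omega := [set w | augmenting adj (partner f w) z].

(** Distinctness and adjacency in [augmenting] do not involve [w]; the other clauses constrain
    finitely many partners. *)
Lemma measurable_augmentable f z : factor_matching f -> measurable (augmentable f z).
Proof.
move=> mf; case: z => [|[a b] t].
  rewrite (_ : augmentable _ _ = set0)//; apply/seteqP; split=> // w.
  by case=> -[a [b [t []]]].
set z := (a, b) :: t.
have [zs|zs] := pselect (uniq (pair_vertices z) /\ {in z, forall p, adj p.1 p.2}); last first.
  rewrite (_ : augmentable _ _ = set0)//; apply/seteqP; split=> // w.
  by case=> _ zu za _; apply: zs.
rewrite (_ : augmentable _ _ = [set w | partner f w a = a] `&`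
    \big[setI/setT]_(x <- pair_vertices z) [set w | partner f w x \in pair_vertices z]).
  apply: measurableI; first exact: (measurable_partner a [set x | x = a] mf).
  apply: bigsetI_measurable => x _.
  exact: (measurable_partner x [set y | y \in pair_vertices z] mf).
rewrite -bigcap_seq; apply/seteqP; split=> w.
  by case=> -[_ [_ [_ [[<- _ _] Ma]]]] _ _ zM; split=> // x /zM.
by case=> Ma zM; case: zs => zu za; split=> //; exists a, b, t.
Qed.

(** Lets an augmentable list of a limit be recognized at a late stage. *)
Lemma eq_augmentable f f' z w :
  (forall x, x \in pair_vertices z -> f (tr x w) = f' (tr x w)) ->
  augmentable f z w -> augmentable f' z w.
Proof.
move=> ff' [[a [b [t [zE Ma]]]] zu za zM]; split=> //.
  exists a, b, t; split=> //; rewrite /partner -ff'//.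
  by rewrite zE mem_cat mem_head.
by move=> x xz; rewrite /partner -ff'//; exact: zM.
Qed.

(* Selecting by [E] makes the switched translates of [z] disjoint: overlapping
   translates differ by some [g^-1 * h]. *)
Definition selected f z (E : set Omega) : set Omega :=
  augmentable f z `&` E `&`
  [set w | forall g h, g \in pair_vertices z -> h \in pair_vertices z ->
             g != h -> ~ E (tr (g^-1 * h)%g w)].

(** The translate of [z] that puts its vertex [g] at the identity is switched. *)
Definition switched f z E w (g : Gamma) : bool := `[< selected f z E (tr g^-1 w) >].

(** The identity is matched along that translate; by [switched_inj] at most one vertex [g]
    qualifies. *)
Definition switch f z E w : Gamma :=
  if [seq g <- pair_vertices z | switched f z E w g] is g :: _
  then (mate z g * g^-1)%g else f w.

Variables (f : Omega -> Gamma) (z : seq (Gamma * Gamma)) (E : set Omega).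
Hypothesis mf : factor_matching f.
Hypothesis mE : measurable E.

Lemma measurable_selected : measurable (selected f z E).
Proof.
apply: measurableI; first by apply: measurableI => //; exact: measurable_augmentable.
rewrite (_ : mkset _ = \big[setI/setT]_(g <- pair_vertices z)
  \big[setI/setT]_(h <- pair_vertices z)
    (if g != h then ~` (tr (g^-1 * h)%g @^-1` E) else setT)).
  apply: bigsetI_measurable => g _; apply: bigsetI_measurable => h _.
  by case: ifP => // _; apply: measurableC; exact: measurable_preimage_tr.
rewrite -bigcap_seq; apply/seteqP; split=> w /= H.
  move=> g gz; rewrite -bigcap_seq => h hz; case: ifPn => // gh.
  exact: H gz hz gh.
move=> g h gz hz gh; have := H g gz; rewrite -bigcap_seq => /(_ h hz).
by rewrite gh.
Qed.

Lemma switched_inj w g h : g \in pair_vertices z -> h \in pair_vertices z ->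
  switched f z E w g -> switched f z E w h -> g = h.
Proof.
move=> gz hz /asboolP[[_ _] gE] /asboolP[[_ hE] _]; apply/eqP/negPn/negP => gh.
apply: (gE h g hz gz); first by rewrite eq_sym.
by rewrite trM -mulgA mulgV mulg1.
Qed.

Lemma switchE w g : g \in pair_vertices z -> switched f z E w g ->
  switch f z E w = (mate z g * g^-1)%g.
Proof.
move=> gz gs; rewrite /switch; case F : [seq _ <- _ | _] => [|h r].
  have : g \in [seq g <- pair_vertices z | switched f z E w g] by rewrite mem_filter gs.
  by rewrite F.
have : h \in [seq g <- pair_vertices z | switched f z E w g] by rewrite F mem_head.
by rewrite mem_filter => /andP[hs hz]; rewrite (switched_inj gz hz gs hs).
Qed.

Lemma switchNE w : (forall g, g \in pair_vertices z -> ~~ switched f z E w g) ->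
  switch f z E w = f w.
Proof.
move=> H; rewrite /switch; case F : [seq _ <- _ | _] => [//|h r].
have : h \in [seq g <- pair_vertices z | switched f z E w g] by rewrite F mem_head.
by rewrite mem_filter => /andP[hs /H]; rewrite hs.
Qed.

Lemma switch_ind w (P : Prop) :
  (forall g, g \in pair_vertices z -> switched f z E w g -> P) ->
  ((forall g, g \in pair_vertices z -> ~~ switched f z E w g) -> P) -> P.
Proof.
move=> H1 H2; have [/hasP[g gz gs]|/hasPn] := boolP (has (switched f z E w) (pair_vertices z)).
  exact: H1 gz gs.
exact: H2.
Qed.

Lemma switched_tr w g h : switched f z E (tr h w) g = switched f z E w (h^-1 * g)%g.
Proof. by rewrite /switched trM invgM invgK. Qed.

(** On a switched translate the new partner is the mate, an involution. Any other vertex keeps its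
    partner, which is on no switched translate either, because the vertices of an augmenting list
    are closed under partners. *)
Lemma switch_matching : factor_matching (switch f z E).
Proof.
have [mfv fS fV] := mf.
have aug w g : switched f z E w g -> uniq (pair_vertices z) /\ {in z, forall p, adj p.1 p.2}.
  by move=> /asboolP[[[_ zu za _] _] _].
split.
- move=> g; rewrite (_ : _ @^-1` _ =
    \big[setU/set0]_(h <- pair_vertices z)
      (if (mate z h * h^-1)%g == g then tr h^-1%g @^-1` selected f z E else set0) `|`
    (f @^-1` [set g] `\`
     \big[setU/set0]_(h <- pair_vertices z) (tr h^-1%g @^-1` selected f z E))).
    apply: measurableU.
      apply: bigsetU_measurable => h _; case: ifP => // _.
      by apply: measurable_preimage_tr; exact: measurable_selected.
    apply: measurableD => //; apply: bigsetU_measurable => h _.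
    by apply: measurable_preimage_tr; exact: measurable_selected.
  rewrite -!bigcup_seq; apply/seteqP; split=> w /=.
    apply: (@switch_ind w) => [h hz hs|H].
      rewrite (switchE hz hs) => <-; left; exists h => //=.
      by rewrite eqxx; exact/asboolP.
    rewrite switchNE// => fg; right; split=> // -[h hz hs].
    by case/negP: (H h hz); exact/asboolP.
  move=> [[h hz]|[fg H]].
    by case: eqP => // <- /asboolP hs; exact: switchE.
  rewrite switchNE// => h hz; apply/negP => /asboolP hs; apply: H; by exists h.
- move=> w; apply: (@switch_ind w) => [g gz gs|H]; last by rewrite switchNE.
  right; rewrite (switchE gz gs); have [zu za] := aug _ _ gs.
  exact: (mate_adj adj_sym zu za gz).
- move=> w; apply: (@switch_ind w) => [g gz gs|H].
    have [zu za] := aug _ _ gs.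
    rewrite (switchE gz gs) (@switchE _ (mate z g)) ?mem_mate//.
      by rewrite mateK// invgM invgK.
    by rewrite switched_tr invgM invgK -mulgA mulVg mulg1.
  rewrite [in LHS](switchNE H) !switchNE//.
  (* Closure under partners, applied at [h], would bring the identity itself onto the switched
     translate. *)
  move=> h hz; rewrite switched_tr; apply/negP => hs.
  have /asboolP[[[_ _ _ zM] _] _] := hs.
  have := zM h hz.
  rewrite invgM invgK /partner trM mulgA mulgV mul1g fV => hz'.
  by have := H _ hz'; rewrite hs.
Qed.

Variable mu : probability Omega R.
Hypothesis mu_prod : is_product_lebesgue mu.

Definition unmatched f' : R := pr mu (f' @^-1` [set 1%g]).

(** No vertex loses its partner, while the first vertex of each switched translate gains one; that
    vertex is the identity with the probability of [selected]. *)
Lemma switch_unmatched : unmatched (switch f z E) + pr mu (selected f z E) <= unmatched f.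
Proof.
(* A selected [w0] yields the facts about [z] alone, namely distinct vertices and adjacent pairs; if
   there is none, nothing is switched. *)
have [[w0 [[+ _] _]]|H] := pselect (exists w, selected f z E w); last first.
  rewrite (_ : selected f z E = set0) ?pr0 ?addr0; last first.
    by apply/seteqP; split=> // w hw; apply: H; exists w.
  rewrite (_ : switch f z E = f)//; apply/funext => w.
  rewrite switchNE// => g _; apply/negP => /asboolP hg.
  by apply: H; eexists; exact: hg.
case=> -[a [b [t [zE _]]]] zu za _.
have az : a \in pair_vertices z by rewrite zE mem_cat mem_head.
rewrite -(pr_tr mu_prod a^-1%g measurable_selected) -prU.
- apply: pr_le.
  + apply: measurableU; first exact: (measurable_values _ switch_matching).
    by apply: measurable_preimage_tr; exact: measurable_selected.
  + exact: measurable_values.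
  + move=> w [|].
      apply: (@switch_ind w) => [g gz gs|H0] /=; last by rewrite switchNE.
      rewrite (switchE gz gs) => mg1.
      by have := mate_adj adj_sym zu za gz; rewrite /adj mg1 (negPf one_notin_gens).
    move=> [[[[a' [b' [t' [+ Ma]]]] _ _ _] _] _].
    rewrite zE => -[aE _ _]; rewrite -aE /partner trM mulgV tr1 in Ma.
    by apply: (mulIg a); rewrite mul1g.
- exact: (measurable_values _ switch_matching).
- by apply: measurable_preimage_tr; exact: measurable_selected.
- apply/seteqP; split=> // w [/= w1 /asboolP hs].
  move: w1; rewrite (switchE az hs) => mg1.
  by have := mate_adj adj_sym zu za az; rewrite /adj mg1 (negPf one_notin_gens).
Qed.

(** The partner of the identity changes only if the identity is one of the [2 * size z] vertices of
    a switched translate, and [switch_unmatched] bounds the measure of [selected]. *)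
Lemma switch_dist : pr mu (~` [set w | f w = switch f z E w]) <=
  (2 * size z)%:R * (unmatched f - unmatched (switch f z E)).
Proof.
have h := switch_unmatched; rewrite -lerBrDl in h.
apply: le_trans (ler_wpM2l (ler0n _ _) h).
have -> : (2 * size z)%N = size (pair_vertices z).
  by rewrite size_cat !size_map mul2n addnn.
apply: (@le_trans _ _ (pr mu (\big[setU/set0]_(g <- pair_vertices z)
                              (tr g^-1%g @^-1` selected f z E)))).
  apply: pr_le.
  - by apply: measurableC; apply: measurable_agree => //; exact: switch_matching.
  - apply: bigsetU_measurable => g _; apply: measurable_preimage_tr.
    exact: measurable_selected.
  - rewrite -bigcup_seq => w /= fw; apply: (@switch_ind w) => [g gz /asboolP gs|H].
      by exists g.
    by case: fw; rewrite switchNE.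
apply: le_trans (pr_bigU_le mu _ _) _.
  by move=> g; apply: measurable_preimage_tr; exact: measurable_selected.
under eq_bigr do rewrite (pr_tr mu_prod _ measurable_selected).
by rewrite big_const_seq count_predT iter_addr_0 -[leLHS]mulr_natl.
Qed.

(** The first vertex of [z] passes from unmatched to matched. Hence no translate is selected once
    partners are final. *)
Lemma selected_changes w : selected f z E w ->
  exists2 x, x \in pair_vertices z & f (tr x w) <> switch f z E (tr x w).
Proof.
move=> ws; have [[[[a [b [t [zE Ma]]]] zu za _] _] _] := ws.
have az : a \in pair_vertices z by rewrite zE mem_cat mem_head.
exists a => //; rewrite (switchE az); last first.
  by rewrite switched_tr mulVg; apply/asboolP; rewrite invg1 tr1.
move=> E0; have := mate_adj adj_sym zu za az; rewrite /adj -E0.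
have -> : f (tr a w) = 1%g by apply: (mulIg a); rewrite mul1g.
by rewrite (negPf one_notin_gens).
Qed.

End factor_matching.

(** * Limits of factor matchings *)

(** Words in the generators form a subgroup, hence exhaust [Gamma], and a finite alphabet has
    countably many words. *)
Lemma generates_countable (Gamma : groupType) (S : {fset Gamma}) :
  symmetric_set S -> generates S -> countable [set: Gamma].
Proof.
move=> symS genS.
pose word (l : seq Gamma) := foldr (fun x y => (x * y)%g) 1%g l.
have wordM l l' : word (l ++ l') = (word l * word l')%g.
  by elim: l => [|s l IH]/=; rewrite ?mul1g// IH mulgA.
pose H : {pred Gamma} := [pred x | `[< exists2 l, {subset l <= S} & x = word l >]].
have HP x : x \in H <-> exists2 l, {subset l <= S} & x = word l.
  by split=> [/asboolP|h]; last exact/asboolP.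
have HT x : x \in H.
  apply: genS => [|s sS]; last first.
    by apply/HP; exists [:: s]; [move=> y; rewrite inE => /eqP->|rewrite /= mulg1].
  split; first by apply/HP; exists [::].
  move=> _ _ /HP[l lS ->] /HP[l' l'S ->]; elim: l' l'S l lS => [|s l' IH] l'S l lS.
    by apply/HP; exists l; rewrite //= invg1 mulg1.
  have /IH/(_ l lS)/HP[m mS mE] : {subset l' <= S}.
    by move=> y yl'; apply: l'S; rewrite inE yl' orbT.
  apply/HP; exists (m ++ [:: s^-1%g]).
    move=> y; rewrite mem_cat inE => /orP[/mS//|/eqP->].
    by apply: symS; apply: l'S; rewrite mem_head.
  by rewrite wordM -mE /= mulg1 invgM mulgA.
have wordP x : exists l : seq S, x = word (map val l).
  have /HP[l lS ->] := HT x; elim: l lS => [|s l IH] lS; first by exists [::].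
  have /IH[l' l'E] : {subset l <= S} by move=> y yl; apply: lS; rewrite inE yl orbT.
  have sS : s \in S by apply: lS; rewrite mem_head.
  by exists ([` sS]%fset :: l'); rewrite /= l'E.
pose f x := choice.pickle (projT1 (cid (wordP x))).
apply/countable_injP; exists f => x y _ _ /(pcan_inj choice.pickleK) E.
by rewrite (projT2 (cid (wordP x))) (projT2 (cid (wordP y))) E.
Qed.

(** [logn 2] takes the value [n] at arbitrarily large arguments, namely at [2 ^ n * (2 * N + 1)]. *)
Lemma recurrent_enumeration (T : Type) (t0 : T) (enc : T -> nat) : injective enc ->
  exists e : nat -> T, forall t N, exists2 i, (N <= i)%N & e i = t.
Proof.
move=> enc_inj.
pose e i := if pselect (exists t, enc t = logn 2 i) is left h then projT1 (cid h) else t0.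
exists e => t N; exists (2 ^ enc t * (2 * N + 1))%N.
  have : (0 < 2 ^ enc t)%N by rewrite expn_gt0.
  by move: (2 ^ enc t)%N => p p0; nia.
have lE : logn 2 (2 ^ enc t * (2 * N + 1)) = enc t.
  rewrite lognM ?expn_gt0// ?addn1// pfactorK// lognE/= dvdn2 /= mul2n odd_double/=.
  by rewrite addn0.
rewrite /e lE; case: pselect => [h|]; last by case; exists t.
by apply: enc_inj; exact: (projT2 (cid h)).
Qed.

(** * Almost sure properties of the labels *)

Section almost_everywhere.
Context {R : realType} {Gamma : groupType}.
Notation Omega := (labels R Gamma).
Notation tr := (@translate_labels R Gamma).
Variable mu : probability Omega R.
Hypothesis mu_prod : is_product_lebesgue mu.
Hypothesis countG : countable [set: Gamma].

Lemma ae_tr (P : Omega -> Prop) g :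
  {ae mu, forall w, P w} -> {ae mu, forall w, P (tr g w)}.
Proof.
move=> [N [mN N0 PN]]; exists (tr g @^-1` N); split.
- exact: measurable_preimage_tr.
- by rewrite (translation_invariant mu_prod).
- by move=> w Pw; exact: PN.
Qed.

Lemma ae_countable (P : Gamma -> Omega -> Prop) :
  (forall x, {ae mu, forall w, P x w}) -> {ae mu, forall w, forall x, P x w}.
Proof.
move=> aeP; have /countable_injP[h h_inj] := countG.
have := @ae_foralln _ _ _ mu (fun n w => forall x, h x = n -> P x w).
move=> H; apply: filterS (H _) => [w Pw x|n]; first exact: (Pw (h x)).
have [[x xn]|nx] := pselect (exists x, h x = n).
  apply: filterS (aeP x) => w Pxw y yn.
  by have -> : y = x by apply: h_inj; rewrite ?inE// yn xn.
by apply: aeW => w x xn; case: nx; exists x.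
Qed.

Lemma ae_pr0 (A : set Omega) : measurable A -> {ae mu, forall w, ~ A w} -> pr mu A = 0.
Proof.
move=> mA [N [mN N0 PN]]; apply/eqP; rewrite eq_le pr_ge0 andbT.
apply: (@le_trans _ _ (pr mu N)); last by rewrite /pr N0.
by apply: pr_le => // w Aw; apply: PN; rewrite /=; apply.
Qed.

(** The cells at two distinct points are independent and uniform: each of the [2 ^ K] possible
    coincidences has probability [2 ^- K] squared. *)
Lemma pr_agree_cell g K : g != 1%g ->
  pr mu [set w | cell K (lab w 1%g) = cell K (lab w g)] <= 2 ^- K.
Proof.
move=> g1; pose F := [fset 1%g; g]%fset.
have cF : #|` F| = 2%N by rewrite cardfs2 eq_sym g1.
pose C j := [set w : Omega | forall x, x \in F -> cell K (lab w x) = j].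
have mC j : measurable (C j) by exact: (measurable_cells F K (fun=> j)).
have CE : [set w | cell K (lab w 1%g) = cell K (lab w g)] =
    \big[setU/set0]_(j < 2 ^ K) C j.
  rewrite -bigcup_mkord; apply/seteqP; split=> w /=.
    move=> E; exists (cell K (lab w 1%g)); first exact: cell_lt.
    by move=> x; rewrite !inE => /orP[]/eqP->.
  by move=> [j _ wj]; rewrite !wj ?inE ?eqxx ?orbT.
rewrite CE; apply: le_trans (pr_bigU_le mu _ (fun j : 'I_(2 ^ K) => mC j)) _.
under eq_bigr do rewrite (pr_cells mu_prod (j := fun=> _)) ?cF//.
by rewrite sumr_const card_ord -[leLHS]mulr_natl natrX expr2 mulrA divff ?mul1r.
Qed.

(** For fixed [g], agreement of all cells has probability at most [2 ^- K] for every [K], and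
    [Gamma] is countable. *)
Lemma labels_separated :
  {ae mu, forall w, forall g, g != 1%g -> exists K, cell K (lab w 1%g) <> cell K (lab w g)}.
Proof.
apply: ae_countable => g; have [->|g1] := eqVneq g 1%g; first exact: aeW.
pose C K := [set w : Omega | cell K (lab w 1%g) = cell K (lab w g)].
have mC K : measurable (C K).
  rewrite (_ : C K =
      \bigcup_j ([set w | cell_set K j (w 1%g)] `&` [set w | cell_set K j (w g)])).
    apply: bigcup_measurable => j _; apply: measurableI;
      by apply: measurable_coordinate; exact: measurable_cell_set.
  apply/seteqP; split=> w; first by move=> wC; exists (cell K (lab w 1%g)).
  by move=> [j _ [wj1 wj2]]; rewrite /C /= /lab wj1 wj2.
have mI : measurable (\bigcap_K C K) by exact: bigcapT_measurable.
exists (\bigcap_K C K); split => //.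
  rewrite prE//; congr EFin; apply/eqP; rewrite eq_le pr_ge0 andbT.
  apply/ler_addgt0Pr => e e0; rewrite add0r.
  pose K := Num.truncn e^-1.
  have Ke : 2 ^- K <= e.
    rewrite -[e]invrK lef_pV2 ?posrE ?invr_gt0 ?exprn_gt0//.
    have /andP[_ /ltW/le_trans] : K%:R <= e^-1 < K.+1%:R.
      by apply: truncn_itv; rewrite invr_ge0 ltW.
    by apply; rewrite -natrX ler_nat ltn_expl.
  apply: le_trans Ke; apply: le_trans (pr_agree_cell K g1).
  by apply: pr_le => //; [exact: mC|exact: bigcap_inf].
move=> w /= H K _; apply: contrapT => wK; apply: H => _; by exists K.
Qed.

End almost_everywhere.

(** * Stabilization by Borel-Cantelli *)

Section matching_limit.
Context {R : realType} {Gamma : groupType}.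
Notation Omega := (labels R Gamma).
Notation tr := (@translate_labels R Gamma).
Variable S : {fset Gamma}.
Variable mu : probability Omega R.
Hypothesis mu_prod : is_product_lebesgue mu.
Hypothesis countG : countable [set: Gamma].

Definition disagree (f g : Omega -> Gamma) : set Omega := ~` [set w | f w = g w].

Variable f : nat -> Omega -> Gamma.
Hypothesis mf : forall i, factor_matching S (f i).

Let eventually_eq g : set Omega := [set w | exists N, forall i, (N <= i)%N -> f i w = g].

Let eventually_eq_inj w g h : eventually_eq g w -> eventually_eq h w -> g = h.
Proof.
move=> [N fN] [N' fN']; rewrite -(fN (maxn N N')) ?leq_maxl//.
by rewrite -(fN' (maxn N N')) ?leq_maxr.
Qed.

Let measurable_eventually_eq g : measurable (eventually_eq g).
Proof.
rewrite (_ : eventually_eq g =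
    \bigcup_N \bigcap_(i in [set i | (N <= i)%N]) (f i @^-1` [set g])).
  apply: bigcup_measurable => N _; apply: bigcap_measurable => [|i _].
    by exists N => /=.
  by have [mfi _ _] := mf i; exact: mfi.
by apply/seteqP; split=> w [N]; [exists N|move=> _ H; exists N].
Qed.

(** Where the values do not stabilize, the identity is declared unmatched, so that the limit is a
    factor matching for every [w]. *)
Definition limit_matching w : Gamma := xget 1%g [set g | eventually_eq g w].

Let limitE w g : eventually_eq g w -> limit_matching w = g.
Proof.
move=> wg; rewrite /limit_matching; case: xgetP => [h _ /= wh|/(_ g)//].
exact: eventually_eq_inj wh wg.
Qed.

Let limit_ind w : eventually_eq (limit_matching w) w \/ limit_matching w = 1%g.
Proof. by rewrite /limit_matching; case: xgetP => [h _ wh|_]; [left|right]. Qed.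

Lemma limit_factor_matching : factor_matching S limit_matching.
Proof.
have limS w : limit_matching w = 1%g \/ limit_matching w \in S.
  have [[N /(_ N (leqnn _)) <-]|->] := limit_ind w; last by left.
  by have [_ fS _] := mf N; exact: fS.
split=> // [g|w].
  have [->|g1] := eqVneq g 1%g; last first.
    rewrite (_ : _ @^-1` _ = eventually_eq g) //.
    apply/seteqP; split=> w /=; last exact: limitE.
    by move=> wg; case: (limit_ind w); rewrite wg// => w1; rewrite w1 eqxx in g1.
  (* The value [1] also stands for the absence of a limit, so its fibre is the complement of the
     others. *)
  rewrite (_ : _ @^-1` _ =
    ~` \big[setU/set0]_(s <- (S `\ 1%g)%fset) eventually_eq s).
    by apply: measurableC; exact: bigsetU_measurable.
  rewrite -bigcup_fset; apply/seteqP; split=> w /=.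
    move=> w1 [s /=]; rewrite in_fsetD1 => /andP[s1 _] /limitE; rewrite w1 => E.
    by rewrite -E eqxx in s1.
  move=> H; have [w1|wS] := limS w; first by [].
  have [E|//] := limit_ind w.
  apply: contrapT => /eqP w1; apply: H; exists (limit_matching w) => //=.
  by rewrite in_fsetD1 w1.
(* If the value at [w] is [g] from stage [N] on, then at the partner it is [g^-1] from the same
   stage on. *)
have [[N H]|w1] := limit_ind w; last by rewrite w1 tr1 w1 invg1.
apply: limitE; exists N => i Ni; have := H i Ni.
by have [_ _ fV] := mf i => E; rewrite -E fV.
Qed.

Lemma measurable_disagree g g' : factor_matching S g -> factor_matching S g' ->
  measurable (disagree g g').
Proof. by move=> mg mg'; apply: measurableC; exact: measurable_agree mg mg'. Qed.

Variable B : R.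
Hypothesis sum_le : forall n, \sum_(i < n) pr mu (disagree (f i) (f i.+1)) <= B.

Let A i := disagree (f i) (f i.+1).
Let mA i : measurable (A i). Proof. exact: measurable_disagree. Qed.

Let series_le : (\sum_(0 <= i <oo) mu (A i) <= B%:E)%E.
Proof.
apply: lime_le; first exact: is_cvg_nneseries.
apply: nearW => n; rewrite big_mkord.
under eq_bigr do rewrite prE//.
by rewrite sumEFin lee_fin.
Qed.

Let eventually_of_tail w N : (forall i, (N <= i)%N -> ~ A i w) -> eventually_eq (f N w) w.
Proof.
move=> H; exists N => i; elim: i => [|i IH]; first by rewrite leqn0 => /eqP ->.
rewrite leq_eqVlt => /orP[/eqP->//|]; rewrite ltnS => Ni.
by apply: contrapT => ne; apply: (H i Ni) => /= E; apply: ne; rewrite -E; exact: IH.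
Qed.

(** Where no two consecutive stages differ the limit is [f 0], so the union bound applies. *)
Lemma limit_matching_dist : pr mu (disagree (f 0) limit_matching) <= B.
Proof.
have mD : measurable (disagree (f 0) limit_matching).
  by apply: measurable_disagree => //; exact: limit_factor_matching.
rewrite -lee_fin -prE//; apply: le_trans series_le.
have mU : measurable (\bigcup_i A i) by exact: bigcup_measurable.
apply: le_trans (generalized_Boole_inequality mu mA mU).
rewrite le_measure ?inE// => w wD; apply: contrapT => wA; apply: wD.
apply/esym/limitE/eventually_of_tail => i _ Aiw; apply: wA; by exists i.
Qed.

(** Borel-Cantelli at the identity; invariance carries it to each [x], and countability to all [x]
    at once. *)
Lemma limit_matching_stable : {ae mu, forall w, forall x,
  exists N, forall i, (N <= i)%N -> f i (tr x w) = limit_matching (tr x w)}.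
Proof.
apply: (ae_countable countG) => x.
apply: (ae_tr mu_prod
  (P := fun w => exists N, forall i, (N <= i)%N -> f i w = limit_matching w)).
exists (lim_sup_set A); split.
- by apply: bigcapT_measurable => n; apply: bigcup_measurable => i _; exact: mA.
- by apply: lim_sup_set_cvg0 => //; apply: le_lt_trans series_le _; rewrite ltry.
- move=> w /= H n _; apply: contrapT => wA; apply: H.
  have /eventually_of_tail wn : forall i, (n <= i)%N -> ~ A i w.
    by move=> i ni Aiw; apply: wA; exists i.
  by have [N H] := wn; exists N => i Ni; rewrite (limitE wn) H.
Qed.

End matching_limit.

(** * Decay of the unmatched density *)

Section exhausting_augmentations.
Context {R : realType} {Gamma : groupType}.
Notation Omega := (labels R Gamma).
Notation tr := (@translate_labels R Gamma).
Variable S : {fset Gamma}.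
Hypothesis symS : symmetric_set S.
Hypothesis simpleS : simple_graph (cayley S).
Hypothesis countG : countable [set: Gamma].
Variable mu : probability Omega R.
Hypothesis mu_prod : is_product_lebesgue mu.

Notation item := (seq (Gamma * Gamma) * (nat * nat))%type.

(** The events [E] of [selected]: as labels almost surely differ, a fine enough cell singles out the
    identity among finitely many points. *)
Definition label_cell (Kj : nat * nat) : set Omega :=
  [set w | cell_set Kj.1 Kj.2 (w 1%g)].

Lemma measurable_label_cell Kj : measurable (label_cell Kj).
Proof. by apply: measurable_coordinate; exact: measurable_cell_set. Qed.

(** Lists of more than [l] pairs are skipped, which gives the factor [2 * l] in [switches_dist]. *)
Fixpoint switches (l : nat) (e : nat -> item) (f : Omega -> Gamma) (i : nat) :
    Omega -> Gamma :=
  if i is i'.+1 then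
    if (size (e i').1 <= l)%N
    then switch S (switches l e f i') (e i').1 (label_cell (e i').2)
    else switches l e f i'
  else f.

Lemma switches_matching l e f i : factor_matching S f ->
  factor_matching S (switches l e f i).
Proof.
move=> mf; elim: i => //= i IH; case: ifP => // _.
by apply: switch_matching => //; exact: measurable_label_cell.
Qed.

Lemma switches_dist l e f i : factor_matching S f ->
  pr mu (disagree (switches l e f i) (switches l e f i.+1)) <=
  (2 * l)%:R * (unmatched mu (switches l e f i) - unmatched mu (switches l e f i.+1)).
Proof.
move=> mf; have mfi := switches_matching l e i mf.
rewrite /=; case: ifP => [zl|_]; last first.
  rewrite /disagree [X in ~` X](_ : _ = setT) ?setCT ?pr0 ?subrr ?mulr0//.
  by apply/seteqP; split.
have mE := measurable_label_cell (e i).2.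
apply: le_trans (switch_dist symS simpleS _ mfi mE mu_prod) _.
rewrite ler_wpM2r ?ler_nat ?leq_mul2l// subr_ge0.
apply: le_trans _ (switch_unmatched symS simpleS (e i).1 mfi mE mu_prod); rewrite lerDl.
exact: pr_ge0.
Qed.

Lemma item_enumeration : exists e : nat -> item,
  forall t N, exists2 i, (N <= i)%N & e i = t.
Proof.
have /countable_injP[h h_inj] := countG.
pose enc (t : item) := choice.pickle ([seq (h p.1, h p.2) | p <- t.1], t.2).
apply: (recurrent_enumeration ([::], (0%N, 0%N)) (enc := enc)).
move=> [z k] [z' k'] /(pcan_inj choice.pickleK) /= [+ ->].
move=> /inj_map -> // [a b] [a' b'] /= [].
by move=> /h_inj; rewrite !inE => -> // /h_inj; rewrite !inE => ->.
Qed.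

(** Every list is tried infinitely often with every cell. One still augmentable in the limit would
    be selected at a stage when its partners are already final, and switching it would change one of
    them. *)
Lemma augmentation_limit f l : factor_matching S f -> exists g,
  [/\ factor_matching S g,
      pr mu (disagree f g) <= (2 * l)%:R * unmatched mu f &
      {ae mu, forall w, forall z, (size z <= l)%N -> ~ augmentable S g z w}].
Proof.
move=> mf; have [e e_rec] := item_enumeration.
pose F := switches l e f.
have mF i : factor_matching S (F i) by exact: switches_matching.
have sumF n : \sum_(i < n) pr mu (disagree (F i) (F i.+1)) <=
    (2 * l)%:R * unmatched mu f.
  (* Telescoping: each stage is paid for by the drop of the unmatched density. *)
  suff : \sum_(i < n) pr mu (disagree (F i) (F i.+1)) <=
      (2 * l)%:R * (unmatched mu f - unmatched mu (F n)).
    move=> /le_trans; apply; rewrite ler_wpM2l// gerBl; exact: pr_ge0.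
  elim: n => [|n IH]; first by rewrite big_ord0 subrr mulr0.
  rewrite big_ord_recr/=; have := switches_dist l e n mf; rewrite -/F; lra.
exists (limit_matching F); split.
- exact: limit_factor_matching mF.
- exact: (limit_matching_dist mF sumF).
- apply: filterS2 (limit_matching_stable mu_prod countG mF sumF)
                  (labels_separated mu_prod countG) => w stable sep z zl zw.
  have [N HN] : exists N, forall i x, (N <= i)%N -> x \in pair_vertices z ->
      F i (tr x w) = limit_matching F (tr x w).
    elim: (pair_vertices z) => [|x s [N HN]]; first by exists 0%N.
    have [N' HN'] := stable x; exists (maxn N N') => i y.
    rewrite geq_max => /andP[Ni N'i]; rewrite inE => /orP[/eqP->|ys]; first exact: HN'.
    exact: HN.
  (* Cells of level [K] tell the label at the identity from those at all [g^-1 * h], so overlapping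
     translates of [z] do not compete for the same cell. *)
  have [K HK] : exists K, forall g h, g \in pair_vertices z -> h \in pair_vertices z ->
      g != h -> cell K (lab w 1%g) <> cell K (lab w (g^-1 * h)%g).
    have cell_mono K K' x : (K <= K')%N -> cell K (lab w 1%g) <> cell K (lab w x) ->
        cell K' (lab w 1%g) <> cell K' (lab w x).
      move=> /subnK <-; elim: (_ - _)%N => // n IH /IH ne E; apply: ne.
      by rewrite -(cell_half _ (lab_ge0 w 1%g)) -(cell_half _ (lab_ge0 w x)) -addSn E.
    have [K HK] : exists K, forall x,
        x \in [seq (g^-1 * h)%g | g <- pair_vertices z, h <- pair_vertices z] ->
        x != 1%g -> cell K (lab w 1%g) <> cell K (lab w x).
      elim: [seq _ | _ <- _, _ <- _] => [|x s [K HK]]; first by exists 0%N.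
      have [->|x1] := eqVneq x 1%g.
        by exists K => y; rewrite inE => /orP[/eqP->|/HK//]; rewrite eqxx.
      have [K' HK'] := sep x x1; exists (maxn K K') => y.
      rewrite inE => /orP[/eqP-> _|ys y1].
        by apply: cell_mono HK'; exact: leq_maxr.
      by apply: cell_mono (HK y ys y1); exact: leq_maxl.
    exists K => g h gz hz gh; apply: HK; first by apply/allpairsP; exists (g, h).
    apply: contraNneq gh => E; apply/eqP.
    by rewrite -[LHS]mulg1 -E mulgA mulgV mul1g.
  (* The item made of [z] and the present cell recurs after [N]. *)
  have [i Ni ei] := e_rec (z, (K, cell K (lab w 1%g))) N.
  have sel : selected S (F i) z (label_cell (K, cell K (lab w 1%g))) w.
    split; first split => //.
      by apply: eq_augmentable zw => x xz; rewrite HN.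
    move=> g h gz hz gh E; apply: (HK g h gz hz gh); move: E.
    by rewrite /label_cell /cell_set/= /lab /translate_labels mul1g => ->.
  have [x xz] := selected_changes symS simpleS sel.
  rewrite HN// -(HN i.+1 x (leqW Ni) xz) => ne; apply: ne.
  by rewrite /F/= ei/= zl.
Qed.

End exhausting_augmentations.

(** * Growth along alternating walks *)

Section decay.
Context {R : realType} {Gamma : groupType}.
Notation Omega := (labels R Gamma).
Notation tr := (@translate_labels R Gamma).
Variable S : {fset Gamma}.
Hypothesis symS : symmetric_set S.
Hypothesis bipS : bipartite (cayley S).
Variable mu : probability Omega R.
Hypothesis mu_prod : is_product_lebesgue mu.
Variable f : Omega -> Gamma.
Hypothesis mf : factor_matching S f.

Lemma pr_values_partition (X : set Omega) : measurable X ->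
  pr mu X = \sum_(g <- (1%g |` S)%fset) pr mu (X `&` f @^-1` [set g]).
Proof.
have [mfv fS _] := mf; move=> mX.
have mXg g : measurable (X `&` f @^-1` [set g]) by exact: measurableI.
have H (r : seq Gamma) : uniq r ->
    pr mu (\big[setU/set0]_(g <- r) (X `&` f @^-1` [set g])) =
    \sum_(g <- r) pr mu (X `&` f @^-1` [set g]).
  elim: r => [|g r IH]; first by rewrite !big_nil pr0.
  move=> /andP[gr ru]; rewrite !big_cons prU ?IH//.
    exact: bigsetU_measurable.
  apply/seteqP; split=> // w [[_ /= wg]].
  by rewrite -bigcup_seq => -[h hr [_ /= wh]]; rewrite -wg wh hr in gr.
rewrite -H ?fset_uniq//; congr (pr mu _); rewrite -bigcup_seq.
apply/seteqP; split=> [w Xw|w [g _ []]//]; exists (f w) => //=.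
by rewrite !inE; case: (fS w) => ->; rewrite ?eqxx ?orbT.
Qed.

(** [B] as seen from the partner of the identity. *)
Definition matched_preimage (B : set Omega) : set Omega := [set w | B (tr (f w) w)].

Lemma matched_preimage_fiber B g :
  matched_preimage B `&` f @^-1` [set g] = tr g @^-1` (B `&` f @^-1` [set g^-1%g]).
Proof.
have [_ _ fV] := mf; apply/seteqP; split=> w /= [Bw fw].
  by move: Bw (fV w); rewrite /matched_preimage/= fw.
have := fV (tr g w); rewrite fw trM mulVg tr1 invgK => {}fw.
by rewrite /matched_preimage/= fw.
Qed.

Lemma measurable_matched_preimage B : measurable B -> measurable (matched_preimage B).
Proof.
move=> mB; have [mfv fS _] := mf.
rewrite (_ : matched_preimage B = \big[setU/set0]_(g <- (1%g |` S)%fset)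
    (matched_preimage B `&` f @^-1` [set g])).
  apply: bigsetU_measurable => g _; rewrite matched_preimage_fiber.
  by apply: measurable_preimage_tr; exact: measurableI.
rewrite -bigcup_seq; apply/seteqP; split=> [w Bw|w [g _ []]//]; exists (f w) => //=.
by rewrite !inE; case: (fS w) => ->; rewrite ?eqxx ?orbT.
Qed.

(** On the event [f = g], passing to the partner is the translation by [g], onto the event
    [f = g^-1]; the set of values is symmetric, so summing over it preserves the measure. *)
Lemma pr_matched_preimage B : measurable B -> pr mu (matched_preimage B) = pr mu B.
Proof.
move=> mB; have [mfv fS _] := mf.
rewrite (pr_values_partition (measurable_matched_preimage mB)) (pr_values_partition mB).
have E g : pr mu (matched_preimage B `&` f @^-1` [set g]) =
    pr mu (B `&` f @^-1` [set g^-1%g]).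
  by rewrite matched_preimage_fiber (pr_tr mu_prod)//; exact: measurableI.
under eq_bigr do rewrite E.
rewrite -(big_map (fun g => g^-1%g) xpredT (fun g => pr mu (B `&` f @^-1` [set g]))).
apply: perm_big; apply: uniq_perm; rewrite ?map_inj_uniq ?fset_uniq//; first exact: invg_inj.
move=> g; apply/mapP/idP => [[h + ->]|gS].
  by rewrite !inE => /orP[/eqP->|/symS->]; rewrite ?invg1 ?eqxx ?orbT.
exists g^-1%g; rewrite ?invgK//; move: gS.
by rewrite !inE => /orP[/eqP->|/symS->]; rewrite ?invg1 ?eqxx ?orbT.
Qed.

(* [w] is in [reachable i] when an alternating walk of [i] steps leads from the
   identity, through its partner, to an unmatched vertex. *)
Fixpoint reachable (i : nat) : set Omega :=
  if i is i'.+1 then matched_preimage (nbhd_set S (reachable i'))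
  else f @^-1` [set 1%g].

Lemma measurable_reachable i : measurable (reachable i).
Proof.
elim: i => [|i IH] /=; first by have [mfv _ _] := mf.
by apply: measurable_matched_preimage; exact: measurable_nbhd_set.
Qed.

Lemma reachable_path i w x : reachable i (tr x w) ->
  exists2 p, path (fun b b' => adj S (partner f w b) b') x p & 
    size p = i /\ partner f w (last x p) = last x p.
Proof.
elim: i x => [|i IH] x /=.
  by move=> fx; exists [::] => //=; split=> //; rewrite /partner fx mul1g.
move=> [s sS]; rewrite /= !trM => /IH[p xp [sp lp]].
exists ((s * f (tr x w) * x)%g :: p) => /=; last by rewrite sp.
by rewrite xp andbT /adj /partner -(mulgA s) mulgK sS.
Qed.

(** If [w] and [tr s w] were both reachable, the walks from [1] and [s] would join across their edge
    into an augmenting list of at most [2 * i + 1] pairs. So the event is almost disjoint from its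
    neighbourhood, which is at least as large. *)
Lemma reachable_small i l :
  {ae mu, forall w, forall z, (size z <= (2 * l).+1)%N -> ~ augmentable S f z w} ->
  (i <= l)%N -> S != fset0 -> pr mu (reachable i) <= 2^-1.
Proof.
move=> aug il S0; have mA := measurable_reachable i.
have mB := measurable_nbhd_set S mA.
have AB0 : pr mu (reachable i `&` nbhd_set S (reachable i)) = 0.
  apply: ae_pr0; first exact: measurableI.
  apply: filterS aug => w noaug [wA [s sS wB]].
  rewrite -(tr1 w) in wA.
  have [p wp [sp lp]] := reachable_path wA; have [q wq [sq lq]] := reachable_path wB.
  have [side sideP] := bipS.
  have adj_side x y : adj S x y -> side x != side y.
    by move=> xy; apply: sideP; exists (y * x^-1)%g; rewrite // -mulgA mulVg mulg1.
  have adj1s : adj S 1%g s by rewrite /adj invg1 mulg1.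
  have [z zaug zsize] := join_alternating_paths (adj_sym symS) adj_side
    (partnerK w mf) (fun x => @partner_adj _ _ S f w x mf) adj1s wp lp wq lq.
  apply: (noaug z) => //; apply: leq_trans zsize _.
  by rewrite sp sq ltnS addnn -mul2n leq_mul2l.
have := nbhd_set_ge mu_prod S0 mA.
have := prDI mu mA mB; rewrite AB0 addr0 => AE.
have : pr mu (reachable i `\` nbhd_set S (reachable i)) + pr mu (nbhd_set S (reachable i)) <= 1.
  rewrite -prU ?pr_le1//.
  - by apply: measurableU => //; exact: measurableD.
  - exact: measurableD.
  - by rewrite setDE -setIA setICl setI0.
rewrite -AE; lra.
Qed.

(** [reachable 0] is the unmatched event, and each of the [l] further steps multiplies the measure
    by at least [k]. *)
Lemma unmatched_decay (k : R) l :
  S != fset0 -> 1 < k ->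
  (forall A, measurable A -> pr mu A <= 2^-1 -> k * pr mu A <= pr mu (nbhd_set S A)) ->
  {ae mu, forall w, forall z, (size z <= (2 * l).+1)%N -> ~ augmentable S f z w} ->
  k ^+ l * unmatched mu f <= 1.
Proof.
move=> S0 k1 expand aug; have k0 : 0 <= k by lra.
suff H i : (i <= l)%N -> k ^+ i * unmatched mu f <= pr mu (reachable i).
  by apply: le_trans (H l (leqnn _)) _; apply: pr_le1; exact: measurable_reachable.
elim: i => [|i IH] il; first by rewrite mul1r.
have mA := measurable_reachable i.
rewrite /= pr_matched_preimage; last exact: measurable_nbhd_set.
apply: le_trans (expand _ mA (reachable_small aug (ltnW il) S0)).
by rewrite exprS -mulrA ler_wpM2l// IH// ltnW.
Qed.

End decay.

(** * From factor matchings to sets of edges *)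

Section perfect_factor.
Context {R : realType} {Gamma : groupType}.
Notation Omega := (labels R Gamma).
Notation tr := (@translate_labels R Gamma).
Variable S : {fset Gamma}.

Definition matching_edges (f : Omega -> Gamma) (w : Omega) : edge_configs S :=
  fun e => `[< exists x, val e = [fset x; partner f w x]%fset >].

(** A vertex [x] witnessing that [e] is chosen lies in [e], so measurability concerns finitely many
    [x]; equivariance rests on [partner_tr]. *)
Lemma matching_edges_factor f : factor_matching S f -> is_factor (matching_edges f).
Proof.
move=> mf; split.
  apply: measurability; first by [].
  move=> _ [_ [e _ [B _ <-]] <-]; rewrite !setTI.
  pose X := [set w | matching_edges f w e = true].
  have mX : measurable X.
    rewrite (_ : X = \big[setU/set0]_(x <- val e)
        [set w | val e = [fset x; partner f w x]%fset]).
      apply: bigsetU_measurable => x _.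
      exact: (measurable_partner x [set y | val e = [fset x; y]%fset] mf).
    rewrite -bigcup_seq; apply/seteqP; split=> w.
      by move=> /asboolP[x ex]; exists x => //=; rewrite ex !inE eqxx.
    by move=> [x _ ex]; apply/asboolP; exists x.
  rewrite (_ : _ @^-1` _ = (if true \in B then X else set0) `|`
      (if false \in B then ~` X else set0)).
    by apply: measurableU; case: ifP => // _; exact: measurableC.
  apply/seteqP; split=> w /=.
    case E : (matching_edges f w e) => Bw; [left|right]; rewrite mem_set// /X/= E.
    by [].
  by case; case: ifP => // /set_mem; rewrite /X/=; case: (matching_edges f w e).
move=> g w; apply/funext => e; apply/asbool_equiv_eq.
have vE : val (edge_mulr g e) = [fset (y * g)%g | y in val e]%fset by [].
rewrite {}vE; split=> -[x ex].
  exists (x * g^-1)%g; apply/fsetP => y.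
  have gK u v : ((u * g)%g == v) = (u == (v * g^-1)%g).
    by apply/eqP/eqP => [<-|->]; rewrite -mulgA ?mulgV ?mulVg mulg1.
  have -> : (y \in val e) = ((y * g)%g \in [fset (y * g)%g | y in val e]%fset).
    by apply/idP/imfsetP => [ye|[y' y'e /mulIg -> //]]; exists y.
  by rewrite ex !inE !gK partner_tr -[in RHS](mulgA x) mulVg mulg1.
exists (x * g)%g; rewrite /= ex imfset_fset2/=; congr [fset _; _]%fset.
by rewrite partner_tr -mulgA mulVg mulg1.
Qed.

Lemma matching_edges_perfect f w : symmetric_set S -> factor_matching S f ->
  (forall x, f (tr x w) <> 1%g) -> perfect_matching (cayley S) (edges_of (matching_edges f w)).
Proof.
move=> symS mf f1.
have adjP x : adj S x (partner f w x).
  by have [_ fS _] := mf; rewrite /adj /partner mulgK; case: (fS (tr x w)) => // /f1.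
split; first by move=> _ [e _ <-]; exact: set_mem (valP e).
move=> x.
have xe : [fset x; partner f w x]%fset \in edges (cayley S).
  apply/mem_set; exists x, (partner f w x); split=> //.
  by exists (partner f w x * x^-1)%g; [exact: adjP|rewrite -mulgA mulVg mulg1].
exists [fset x; partner f w x]%fset; split.
  split; last by rewrite !inE eqxx.
  by exists (exist (fun e => e \in edges (cayley S)) _ xe) => //=; apply/asboolP; exists x.
move=> _ [[e /asboolP[y ->] <-]].
rewrite !inE => /orP[] /eqP -> //; rewrite (partnerK w mf) fsetUC //.
Qed.

End perfect_factor.

(** * Convergence of the successive matchings *)

Lemma linear_geometric_bound (R : realType) (q : R) : 0 < q -> q < 1 ->
  exists B, forall n, \sum_(i < n) (4 * i%:R + 2) * q ^+ i <= B.
Proof.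
move=> q0 q1; have r0 : 0 < 1 - q by lra.
(* [a] and [b] solve [a * n + b - q * (a * (n + 1) + b) = 4 * n + 2] for all [n], so the partial
   sums telescope. *)
pose a := 4 / (1 - q); pose b := (2 + a * q) / (1 - q).
have a0 : 0 < a by rewrite divr_gt0.
have b0 : 0 < b by rewrite divr_gt0// addr_gt0// mulr_gt0.
exists b => n.
suff -> : \sum_(i < n) (4 * i%:R + 2) * q ^+ i = b - (a * n%:R + b) * q ^+ n.
  by rewrite gerBl mulr_ge0 ?exprn_ge0 ?ltW// ltr_wpDl// mulr_ge0// ltW.
elim: n => [|n IH]; first by rewrite big_ord0 mulr0 add0r mulr1 subrr.
rewrite big_ord_recr/= IH exprS -natr1 /b /a; field; lra.
Qed.

Theorem theorem1p1 (R : realType) (Gamma : groupType) (S : {fset Gamma})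
    (mu : probability (labels R Gamma) R) :
  symmetric_set S -> generates S ->
  simple_graph (cayley S) -> bipartite (cayley S) ->
  nonamenable R (cayley S) ->
  is_product_lebesgue mu ->
  exists phi : labels R Gamma -> edge_configs S,
    is_factor phi /\
    {ae mu, forall w, perfect_matching (cayley S) (edges_of (phi w))}.
Proof.
move=> symS genS simS bipS naS mu_prod.
have countG := generates_countable symS genS.
have S0 := nonamenable_gens naS.
have [k k1 expand] := expansion mu_prod symS naS.
have k0 : 0 < k by lra.
(* Stage [n] removes all augmenting lists of at most [2 * n + 1] pairs. As an implication, [step] is
   satisfiable for every argument, as [choice] demands. *)
pose step (nf : nat * (labels R Gamma -> Gamma)) g := factor_matching S nf.2 ->
  [/\ factor_matching S g,
      pr mu (disagree nf.2 g) <= (2 * (2 * nf.1).+1)%:R * unmatched mu nf.2 &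
      {ae mu, forall w, forall z, (size z <= (2 * nf.1).+1)%N -> ~ augmentable S g z w}].
have [next nextP] : {next & forall nf, step nf (next nf)}.
  apply: choice => -[n f]; have [mf|nmf] := pselect (factor_matching S f).
    have [g gP] := augmentation_limit symS simS countG mu_prod (2 * n).+1 mf.
    by exists g => _.
  by exists f => /nmf.
pose f := fix f n := if n is n'.+1 then next (n', f n') else fun=> 1%g.
have mf n : factor_matching S (f n).
  elim: n => [|n IH]; last by have [] := nextP (n, f n) IH.
  split=> [g|w|w] /=; [|by left|by rewrite invg1].
  have [->|/eqP g1] := eqVneq g 1%g.
    by rewrite (_ : _ @^-1` _ = setT)//; apply/seteqP; split.
  by rewrite (_ : _ @^-1` _ = set0)//; apply/seteqP; split=> // w /= /esym/g1.
(* Stage [n.+1] has decay exponent [n], hence the extra factor [k], which also covers the trivial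
   bound [1] at stage [0]. *)
have unm n : unmatched mu (f n) <= k * k^-1 ^+ n.
  case: n => [|n].
    rewrite expr0 mulr1; apply: le_trans (ltW k1); apply: pr_le1.
    by have [mfv _ _] := mf 0%N; exact: mfv.
  have [_ _ aug] := nextP (n, f n) (mf n).
  have := unmatched_decay symS bipS mu_prod (mf n.+1) S0 k1 expand aug.
  rewrite exprS mulrA divff ?gt_eqF// mul1r exprVn -[_^-1]mul1r.
  by rewrite ler_pdivlMr ?exprn_gt0// mulrC.
have q0 : 0 < k^-1 by rewrite invr_gt0.
have q1 : k^-1 < 1 by rewrite invf_lt1.
have [B0 HB0] := linear_geometric_bound q0 q1.
have sum_le n : \sum_(i < n) pr mu (disagree (f i) (f i.+1)) <= k * B0.
  apply: le_trans (ler_wpM2l (ltW k0) (HB0 n)); rewrite mulr_sumr.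
  apply: ler_sum => i _; have [_ h _] := nextP (nat_of_ord i, f i) (mf i).
  apply: le_trans h _ => /=.
  have -> : (2 * (2 * i).+1)%:R = 4 * i%:R + 2 :> R.
    by rewrite -natrM -natrD; congr (_%:R); lia.
  by rewrite mulrCA ler_wpM2l ?addr_ge0// ?mulr_ge0.
pose g := limit_matching f; have mg := limit_factor_matching mf.
(* The probability of being unmatched at all stages from [N] on is at most the unmatched density of
   each of them, which tends to [0]. *)
have never N : {ae mu, forall w, ~ forall i, (N <= i)%N -> f i w = 1%g}.
  pose X := \bigcap_(i in [set i | (N <= i)%N]) (f i @^-1` [set 1%g]).
  have mX : measurable X.
    apply: bigcap_measurable => [|i _]; first by exists N => /=.
    by have [mfv _ _] := mf i; exact: mfv.
  exists X; split=> //.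
    rewrite prE//; congr EFin; apply/eqP; rewrite eq_le pr_ge0 andbT.
    apply/ler_addgt0Pr => e e0; rewrite add0r.
    (* The tolerance [e / k] absorbs the factor [k] of [unm]. *)
    have /cvgrPdist_le/(_ (e / k)) : k^-1 ^+ n @[n --> \oo] --> (0 : R).
      by apply: cvg_expr; rewrite ger0_norm// ltW.
    move=> /(_ (divr_gt0 e0 k0))[M _ /(_ (maxn M N) (leq_maxl _ _))] /=.
    rewrite sub0r normrN ger0_norm ?(exprn_ge0 _ (ltW q0))// ler_pdivlMr// mulrC => h.
    apply: le_trans h; apply: le_trans (unm (maxn M N)).
    apply: pr_le => //; first by have [mfv _ _] := mf (maxn M N); exact: mfv.
    by move=> w Xw; apply: Xw; rewrite /= leq_maxr.
  by move=> w H i Ni; apply: contrapT => fi; apply: H => /(_ i Ni).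
exists (matching_edges g); split; first exact: matching_edges_factor.
have ever : {ae mu, forall w, forall x N,
    ~ forall i, (N <= i)%N -> f i (translate_labels x w) = 1%g}.
  apply: (ae_countable countG) => x; apply: ae_foralln => N.
  exact: (ae_tr mu_prod (P := fun w => ~ forall i, (N <= i)%N -> f i w = 1%g)).
apply: filterS2 ever (limit_matching_stable mu_prod countG mf sum_le) => w ever stable.
apply: matching_edges_perfect => // x g1.
(* A vertex unmatched in the limit is, by stability, unmatched at all late stages, which [ever]
   excludes. *)
have [N HN] := stable x; apply: (ever x N) => i Ni.
by rewrite HN.
Qed.
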